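(* Let $\Omega\subset\mathbb{R}^n$ be compact and $p\geq 1$. Let $f:[0,+\infty]\to[0,+\infty]$ be lower semicontinuous and convex with $f(0)=0$ and $\lim_{t\to+\infty}f(t)/t=+\infty$, and let $g:[0,1]\to[0,+\infty]$ be subadditive and lower semicontinuous with $g(0)=0$ and $\lim_{t\to0^+}g(t)/t=+\infty$. Then the minimization problem $$\min\{\mathfrak{F}^p(\mu,\nu)\ :\ \mu,\nu\in\mathcal{P}(\Omega)\}$$ has at least one solution.
   Context: $\mathcal{P}(\Omega)$ denotes the set of Borel probability measures on $\Omega$, with the weak-* topology. For $\mu,\nu\in\mathcal{P}(\Omega)$, $T_p(\mu,\nu)=\inf_\gamma\int_{\Omega\times\Omega}|x-y|^p\,d\gamma(x,y)$, the infimum being over all probability measures $\gamma$ on $\Omega\times\Omega$ with marginals $\mu$ and $\nu$. $F(\mu)=\int_\Omega f(u(x))\,dx$ if $\mu=u\cdot\mathcal{L}^n$ with $u\in L^1(\Omega)$, and $F(\mu)=+\infty$ otherwise. $G(\nu)=\sum_{i}g(a_i)$ if $\nu=\sum_{i=0}^\infty a_i\delta_{x_i}$ is purely atomic (distinct points $x_i$, $a_i\geq 0$), and $G(\nu)=+\infty$ if $\nu$ is not purely atomic. Finally $\mathfrak{F}^p(\mu,\nu)=T_p(\mu,\nu)+F(\mu)+G(\nu)$. *)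

(* Defs.v *)
From HB Require Import structures.
From mathcomp Require Import all_boot all_order all_algebra.
From mathcomp Require Import all_classical all_reals all_analysis.
Set Implicit Arguments. Unset Strict Implicit. Unset Printing Implicit Defensive.
Import Order.TTheory GRing.Theory Num.Theory.
Import numFieldNormedType.Exports.
Local Open Scope classical_set_scope.
Local Open Scope ring_scope.

Definition Rn (R : realType) (n : nat) :=
  g_sigma_algebraType (@open 'rV[R]_n).

Definition enorm (R : realType) (n : nat) (x : 'rV[R]_n) : R :=
  Num.sqrt (\sum_(i < n) (x ord0 i) ^+ 2).

Definition box (R : realType) (n : nat) (a b : 'rV[R]_n) : set (Rn R n) :=
  [set x : 'rV[R]_n | forall i, a ord0 i <= x ord0 i <= b ord0 i].

(* lam is (the Borel restriction of) the n-dimensional Lebesgue measure: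
   it gives every box its volume (this determines it uniquely on Borel sets). *)
Definition is_lebesgue (R : realType) (n : nat)
    (lam : {measure set (Rn R n) -> \bar R}) : Prop :=
  forall a b : 'rV[R]_n, (forall i, a ord0 i <= b ord0 i) ->
    lam (box a b) = (\prod_(i < n) (b ord0 i - a ord0 i))%:E.

Definition in_P (R : realType) (n : nat) (Om : set 'rV[R]_n)
    (mu : probability (Rn R n) R) : Prop :=
  mu (~` (Om : set (Rn R n))) = 0%E.

Definition coupling (R : realType) (n : nat) (mu nu : probability (Rn R n) R)
    (gam : probability (Rn R n * Rn R n)%type R) : Prop :=
  (forall A : set (Rn R n), measurable A -> gam (fst @^-1` A) = mu A) /\
  (forall B : set (Rn R n), measurable B -> gam (snd @^-1` B) = nu B).

Definition Tp (R : realType) (n : nat) (p : R) (mu nu : probability (Rn R n) R)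
  : \bar R :=
  ereal_inf [set (\int[gam]_(z in setT) ((enorm (z.1 - z.2 : 'rV[R]_n)) `^ p)%:E)%E
            | gam in [set gam | coupling mu nu gam]].

(* F(mu) = \int_Omega f(u) if mu = u L^n with u in L^1(Omega), +oo otherwise.
   Any two densities agree a.e., so taking the infimum over all densities
   yields that value (and +oo when there is no density). *)
Definition is_density (R : realType) (n : nat) (Om : set 'rV[R]_n)
    (lam : {measure set (Rn R n) -> \bar R}) (mu : probability (Rn R n) R)
    (u : Rn R n -> R) : Prop :=
  [/\ measurable_fun (Om : set (Rn R n)) u,
      (forall x, Om x -> 0 <= u x),
      lam.-integrable (Om : set (Rn R n)) (EFin \o u) &
      forall A : set (Rn R n), measurable A ->
        mu A = (\int[lam]_(x in A `&` (Om : set (Rn R n))) (u x)%:E)%E].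

Definition Ffun (R : realType) (n : nat) (Om : set 'rV[R]_n)
    (lam : {measure set (Rn R n) -> \bar R}) (f : \bar R -> \bar R)
    (mu : probability (Rn R n) R) : \bar R :=
  ereal_inf [set (\int[lam]_(x in (Om : set (Rn R n))) f (u x)%:E)%E
            | u in [set u | is_density Om lam mu u]].

(* G(nu) = sum_i g(a_i) if nu = sum_i a_i delta_{x_i} is purely atomic,
   +oo otherwise.  nu is purely atomic iff it is concentrated on its
   (countably many) atoms {x | nu{x} > 0}; the sum is taken over the atoms
   (terms with a_i = 0 contribute g(0) = 0 in the paper's convention). *)
Definition atoms (R : realType) (n : nat) (nu : probability (Rn R n) R)
  : set (Rn R n) := [set x | (0 < nu [set x])%E].

Definition Gfun (R : realType) (n : nat) (g : R -> \bar R)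
    (nu : probability (Rn R n) R) : \bar R :=
  if nu (~` atoms nu) == 0%E then
    (\esum_(x in atoms nu) g (fine (nu [set x])))%E
  else +oo%E.

Definition Fp (R : realType) (n : nat) (Om : set 'rV[R]_n) (p : R)
    (lam : {measure set (Rn R n) -> \bar R}) (f : \bar R -> \bar R)
    (g : R -> \bar R) (mu nu : probability (Rn R n) R) : \bar R :=
  (Tp p mu nu + Ffun Om lam f mu + Gfun g nu)%E.

Definition lsc_on {X : topologicalType} (R : realType) (D : set X)
    (h : X -> \bar R) : Prop :=
  forall x, D x -> forall a : R, (a%:E < h x)%E ->
    exists2 V, nbhs x V & forall y, V y -> D y -> (a%:E < h y)%E.

(* Main.v *)
Require Import Defs.
From HB Require Import structures.
From mathcomp Require Import all_boot all_order all_algebra.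
From mathcomp Require Import all_classical all_reals all_analysis.
From mathcomp Require Import measurable_realfun measurable_fun_approximation.
From mathcomp Require Import ring lra.
Import Order.TTheory GRing.Theory Num.Theory.
Import numFieldNormedType.Exports.
Local Open Scope classical_set_scope.
Local Open Scope ring_scope.
Set Implicit Arguments. Unset Strict Implicit. Unset Printing Implicit Defensive.

(** The infimum is attained by the direct method, with almost everywhere
convergence in place of weak topologies. A pair of finite energy is replaced by
its atoms [x i], their masses [a i] and the densities [w i] of the parts of [mu]
sent to [x i] by a nearly optimal plan; each term of the energy is then a convex
function of [w]. Along a minimizing sequence the points, masses and energies
converge up to a subsequence; no mass is lost among the atoms because [g] is
steep at 0. A Komlos-type argument gives midpoint combinations of the [w] that
converge almost everywhere: minimize the strictly convex functional
[\sum_i 2^-(i+1) \int (1 + w i)^-1] over the tails of the sequence. Fatou's lemma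
passes all convex bounds to the limit, and the superlinearity of [f] keeps the
masses. Countable subadditivity of [g] covers limit atoms that collide. *)

(** The obstacle is that [Gfun] is in general not convex, so minimizing pairs cannot be averaged
    directly. It depends on the masses alone, while for fixed points the transport and density terms
    are convex in the [w i]. Points, masses and energies are therefore made to converge before any
    averaging, and moving points are replaced by their limits, so that averages are only inserted
    into fixed convex functionals. The function [(1 + t)^-1] is bounded, hence integrable for any
    family on a set of finite measure, and a small convexity defect forces its values, not the
    possibly large densities, to be close. Fatou's lemma only gives upper bounds, and each mass must
    also be bounded below: for this the upper bound is applied to the convex function
    [Num.max (t0 - t) 0], which is large where the density is small. Energies appear as real upper
    bounds throughout, since a candidate whose energy is at most the infimum is already a
    minimizer. *)

(** * Lower limits and Fatou's lemma *)

Lemma limn_einf_ge (R : realType) (u : nat -> \bar R) (l : \bar R) :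
  (forall a : R, (a%:E < l)%E -> \forall k \near \oo, (a%:E <= u k)%E) ->
  (l <= limn_einf u)%E.
Proof.
move=> H; rewrite limn_einf_lim.
have le_a a : (a%:E < l)%E -> (a%:E <= limn (einfs u))%E.
  move=> /H [N _ HN].
  apply: lime_ge; first exact: is_cvg_einfs.
  exists N => // m /= Nm; apply: le_ereal_inf_tmp => _ [k /= mk <-].
  by apply: HN => /=; exact: leq_trans mk.
case: l H le_a => [r| |] H le_a.
- apply/lee_addgt0Pr => e e0; rewrite -leeBlDr// -EFinB; apply: le_a.
  by rewrite lte_fin ltrBlDr ltrDl.
- by rewrite leye_eq; apply/eqP/eqyP => A _; apply: le_a; rewrite ltry.
- by rewrite leNye.
Qed.

Lemma lt_limn_einf (R : realType) (u : nat -> \bar R) (a : \bar R) :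
  (a < limn_einf u)%E -> \forall k \near \oo, (a <= u k)%E.
Proof.
rewrite limn_einf_lim (cvg_lim _ (cvg_einfs_sup (u := u)))//.
move=> /ereal_sup_gt[_ [N _ <-] aN]; exists N => // k /= Nk.
by apply: le_trans (ltW aN) _; apply: ereal_inf_lbound; exists k.
Qed.

(** Thresholds [a] below [h x] express that the lower limit of [F k x] is at least [h x], the value
    [+oo] included; lower semicontinuity along a convergent sequence yields exactly this. The slack
    [e] admits bounds that hold only asymptotically. *)
Lemma fatou_bound d (T : measurableType d) (R : realType)
    (mu : {measure set T -> \bar R}) (F : nat -> T -> \bar R) (h : T -> \bar R)
    (B : R) :
  (forall k, measurable_fun setT (F k)) -> (forall k x, (0 <= F k x)%E) ->
  measurable_fun setT h -> (forall x, (0 <= h x)%E) ->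
  {ae mu, forall x, forall a : R, (a%:E < h x)%E ->
    \forall k \near \oo, (a%:E <= F k x)%E} ->
  (forall e : R, 0 < e -> \forall k \near \oo,
    (\int[mu]_x F k x <= (B + e)%:E)%E) ->
  (\int[mu]_x h x <= B%:E)%E.
Proof.
move=> mF F0 mh h0 hF FB.
apply: (@le_trans _ _ (\int[mu]_x limn_einf (F ^~ x))%E).
  apply: ae_ge0_le_integral => //.
  - move=> x _; apply: limn_einf_ge => a a0.
    by apply: nearW => k; apply: le_trans (ltW a0) (F0 _ _).
  - apply: measurableT_comp => //; apply: measurable_fun_limn_esup => k.
    by apply: measurableT_comp.
  - by apply: filterS hF => x Hx _; exact: limn_einf_ge.
apply: le_trans (fatou mu measurableT mF (fun k x _ => F0 k x)) _.
rewrite limn_einf_lim; apply/lee_addgt0Pr => e e0.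
apply: lime_le; first exact: is_cvg_einfs.
have [N _ HN] := FB e e0.
exists N => // m /= Nm; apply: le_trans (HN m Nm).
by apply: ereal_inf_lbound; exists m => /=.
Qed.

(** * Measures with a density, and comparison of densities *)

Section density_measure.
Context d (T : measurableType d) (R : realType).
Variables (mu : {measure set T -> \bar R}) (w : T -> R).
Hypotheses (mw : measurable_fun setT w) (w0 : forall x, 0 <= w x).

(** The two proofs are arguments, so that the measure structure attaches to the term itself. *)
Definition density_measure of measurable_fun setT w & (forall x, 0 <= w x) :=
  fun A : set T => (\int[mu]_(x in A) (w x)%:E)%E.

Local Notation nu := (density_measure mw w0).

Let nu0 : nu set0 = 0%E. Proof. exact: integral_set0. Qed.

Let nu_ge0 A : (0 <= nu A)%E.
Proof. by apply: integral_ge0 => x _; rewrite lee_fin. Qed.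

Let nu_sigma_additive : semi_sigma_additive nu.
Proof.
move=> F mF tF mUF; rewrite /density_measure ge0_integral_bigcup//; last 2 first.
- exact/measurable_funTS/measurable_EFinP.
- by move=> x _; rewrite lee_fin.
by apply: is_cvg_nneseries => k _ _; exact: nu_ge0.
Qed.

HB.instance Definition _ :=
  isMeasure.Build d T R nu nu0 nu_ge0 nu_sigma_additive.

End density_measure.

Section integral_density.
Local Open Scope ereal_scope.
Context d (T : measurableType d) (R : realType).
Variables (mu nu : {measure set T -> \bar R}) (w : T -> R).
Hypotheses (mw : measurable_fun setT w) (w0 : forall x, (0 <= w x)%R).
Hypothesis nuE : forall A, measurable A -> nu A = \int[mu]_(x in A) (w x)%:E.

Import HBNNSimple.

Lemma integral_density_nnsfun (h : {nnsfun T >-> R}) :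
  \int[nu]_x (h x)%:E = \int[mu]_x ((h x)%:E * (w x)%:E).
Proof.
under eq_integral do rewrite fimfunE -fsumEFin//.
rewrite ge0_integral_fsum//; last 2 first.
  - by move=> y; exact/measurable_EFinP/measurable_funM.
  - by move=> y x _; rewrite nnfun_muleindic_ge0.
have -> : \int[mu]_x ((h x)%:E * (w x)%:E) = \int[mu]_x
    (\sum_(y \in range h) (y * \1_(h @^-1` [set y]) x)%:E * (w x)%:E).
  apply: eq_integral => x _; rewrite [in LHS]fimfunE -fsumEFin//.
  rewrite !fsbig_finite//= ge0_sume_distrl// => y _.
  exact: nnfun_muleindic_ge0.
rewrite ge0_integral_fsum//; last 2 first.
  - move=> y; apply: emeasurable_funM; last exact/measurable_EFinP.
    exact/measurable_EFinP/measurable_funM.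
  - move=> y x _; apply: mule_ge0; last by rewrite lee_fin.
    exact: nnfun_muleindic_ge0.
apply: eq_fsbigr => y /[!inE] -[t _ <-].
have mA : measurable (h @^-1` [set h t]) by [].
under eq_integral do rewrite EFinM.
under [RHS]eq_integral do rewrite EFinM -muleA.
rewrite ge0_integralZl//; last 2 first.
  exact/measurable_EFinP.
  by rewrite lee_fin.
rewrite [RHS]ge0_integralZl//; last 3 first.
  by apply: emeasurable_funM; exact/measurable_EFinP.
  by move=> x _; rewrite mule_ge0// ?lee_fin.
  by rewrite lee_fin.
congr (_ * _); rewrite integral_indic// setIT nuE// integral_mkcond.
apply: eq_integral => x _; rewrite patchE indicE.
by case: (x \in _); rewrite ?mul1e ?mul0e.
Qed.

Lemma integral_density (h : T -> \bar R) :
  measurable_fun setT h -> (forall x, 0 <= h x) ->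
  \int[nu]_x h x = \int[mu]_x (h x * (w x)%:E).
Proof.
move=> mh h0; pose h_ := nnsfun_approx measurableT mh.
have h_cvg x : (EFin \o h_^~ x) @ \oo --> h x.
  by apply: cvg_nnsfun_approx.
have h_nd x : {homo h_^~ x : m n / (m <= n)%N >-> (m <= n)%R}.
  by move=> m n mn; exact/lefP/nd_nnsfun_approx.
transitivity (limn (fun n => \int[nu]_x (h_ n x)%:E)).
  rewrite -monotone_convergence//.
  - by apply: eq_integral => x _; apply/esym/cvg_lim => //; exact: h_cvg.
  - by move=> n; exact/measurable_EFinP.
  - by move=> n x _; rewrite lee_fin.
  - by move=> x _ m n mn; rewrite lee_fin h_nd.
under eq_fun do rewrite integral_density_nnsfun.
rewrite -monotone_convergence//.
- apply: eq_integral => x _; apply/cvg_lim => //.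
  by apply: cvgeZr => //; exact: h_cvg.
- by move=> n; apply: emeasurable_funM; exact/measurable_EFinP.
- by move=> n x _; rewrite mule_ge0// ?lee_fin.
- by move=> x _ m n mn; rewrite lee_wpmul2r// lee_fin// h_nd.
Qed.

End integral_density.

(** The restriction of [mu] to [D] is the measure with density [\1_D]. *)
Lemma ge0_integral_mrestr d (T : measurableType d) (R : realType)
    (mu : {measure set T -> \bar R}) (D : set T) (mD : measurable D)
    (h : T -> \bar R) :
  measurable_fun setT h -> (forall x, (0 <= h x)%E) ->
  (\int[mrestr mu mD]_x h x = \int[mu]_(x in D) h x)%E.
Proof.
move=> mh h0.
have m1 : measurable_fun setT (\1_D : T -> R) by exact: measurable_indic.
rewrite (integral_density (mu := mu) (w := \1_D))//; last first.
  by move=> A mA; rewrite integral_indic// setIC.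
rewrite [RHS]integral_mkcond; apply: eq_integral => x _.
by rewrite patchE indicE; case: (x \in D); rewrite ?mule1 ?mule0.
Qed.

(** Tested on the set where [h2 < h1], the hypothesis makes the integral of the positive function
    [h1 - h2] nonpositive; the finite integral of [h2] may be cancelled from both sides. *)
Lemma ae_le_of_integral_le d (T : measurableType d) (R : realType)
    (mu : {measure set T -> \bar R}) (h1 h2 : T -> R) :
  measurable_fun setT h1 -> measurable_fun setT h2 ->
  (forall x, 0 <= h1 x) -> (forall x, 0 <= h2 x) ->
  (\int[mu]_x (h2 x)%:E < +oo)%E ->
  (forall A, measurable A ->
    (\int[mu]_(x in A) (h1 x)%:E <= \int[mu]_(x in A) (h2 x)%:E)%E) ->
  {ae mu, forall x, h1 x <= h2 x}.
Proof.
move=> mh1 mh2 h10 h20 h2oo h12.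
pose A := [set x | h2 x < h1 x].
have mA : measurable A.
  rewrite -[A]setTI; have := measurable_fun_ltr mh2 mh1.
  by move=> /(_ measurableT [set true]); apply.
have := h12 A mA.
have -> : (\int[mu]_(x in A) (h1 x)%:E = \int[mu]_(x in A) (h2 x)%:E +
    \int[mu]_(x in A) (h1 x - h2 x)%:E)%E.
  rewrite -ge0_integralD//.
  - by apply: eq_integral => x _; rewrite -EFinD addrC subrK.
  - by move=> x _; rewrite lee_fin.
  - exact/measurable_funTS/measurable_EFinP.
  - by move=> x xA; rewrite lee_fin subr_ge0 ltW.
  - by apply/measurable_funTS/measurable_EFinP; exact: measurable_funB.
rewrite -[leRHS]adde0 leeD2lE; last first.
  rewrite ge0_fin_numE; last by apply: integral_ge0 => x _; rewrite lee_fin.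
  apply: le_lt_trans h2oo; apply: ge0_subset_integral => //.
  - exact/measurable_EFinP.
  - by move=> x _; rewrite lee_fin.
move=> le0.
have mD : measurable_fun A (fun x => (h1 x - h2 x)%:E).
  by apply/measurable_funTS/measurable_EFinP; exact: measurable_funB.
have : (\int[mu]_(x in A) `|(h1 x - h2 x)%:E| = 0)%E.
  apply/eqP; rewrite eq_le integral_ge0// andbT; apply: le_trans le0.
  rewrite le_eqVlt; apply/orP; left; apply/eqP; apply: eq_integral => x.
  by move=> /set_mem xA; rewrite gee0_abs// lee_fin subr_ge0 ltW.
move/(ae_eq_integral_abs mu mA mD); apply: filterS => x /= Hx.
rewrite leNgt; apply/negP => xA; have /= [/eqP] := Hx xA.
by rewrite subr_eq0 => /eqP e; move: xA; rewrite e ltxx.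
Qed.

(** Normalization produces a bundled [probability] and changes nothing when the total mass is 1; the
    Dirac mass is only its value for a degenerate total mass. *)
Lemma probability_of_measure d (T : measurableType d) (R : realType)
    (m : {measure set T -> \bar R}) : m setT = 1%E ->
  exists P : probability T R, forall A, P A = m A.
Proof.
move=> m1; exists (mnormalize m (@dirac _ T point R)) => A.
by rewrite /= /mnormalize m1 onee_eq0 /= invr1 mule1.
Qed.

(** * Almost everywhere convergence of midpoint combinations *)

(** Iterated midpoints of the tail from [k], the same combination being used for every index [i].
    With equal weights only, each convexity estimate reduces to one midpoint inequality. *)
Inductive midhull (T : Type) (R : realType) (w : nat -> nat -> T -> R) (k : nat) :
    (nat -> T -> R) -> Prop :=
| midhull_base m : (k <= m)%N -> midhull w k (w m)
| midhull_mid u v : midhull w k u -> midhull w k v ->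
    midhull w k (fun i x => (u i x + v i x) / 2).

Lemma midhull_le (T : Type) (R : realType) (w : nat -> nat -> T -> R) k l u :
  (k <= l)%N -> midhull w l u -> midhull w k u.
Proof.
move=> kl; elim=> [m lm|u1 u2 _ IH1 _ IH2].
  by apply: midhull_base; exact: leq_trans lm.
exact: midhull_mid.
Qed.

Lemma midhull_near (T : Type) (R : realType) (w : nat -> nat -> T -> R)
    (P : (nat -> T -> R) -> Prop) :
  (forall u v, P u -> P v -> P (fun i x => (u i x + v i x) / 2)) ->
  (\forall m \near \oo, P (w m)) ->
  \forall k \near \oo, forall u, midhull w k u -> P u.
Proof.
move=> Pmid [N _ HN]; exists N => // k /= Nk u.
elim=> [m km|u1 u2 _ IH1 _ IH2]; last exact: Pmid.
by apply: HN => /=; exact: leq_trans km.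
Qed.

(** Strict convexity of [(1 + t)^-1], with the defect measured by the function's own values. With
    [a = 1 + s] and [b = 1 + t] the difference of the two sides factors, and the only factor of
    unclear sign, [2ab - (a + b)], is nonnegative because [a] and [b] are at least 1. *)
Lemma inv1D_midpoint (R : realType) (s t : R) : 0 <= s -> 0 <= t ->
  (1 + (s + t) / 2)^-1 + (1 + (s + t) / 2)^-1 +
    ((1 + s)^-1 - (1 + t)^-1) ^+ 2 / 2 <= (1 + s)^-1 + (1 + t)^-1.
Proof.
move=> s0 t0.
have s1 : 0 < 1 + s by rewrite ltr_pwDl.
have t1 : 0 < 1 + t by rewrite ltr_pwDl.
pose a := 1 + s; pose b := 1 + t.
have a1 : 1 <= a by rewrite lerDl.
have b1 : 1 <= b by rewrite lerDl.
have a0 : a != 0 by rewrite gt_eqF.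
have b0 : b != 0 by rewrite gt_eqF.
have ab0 : a + b != 0 by rewrite gt_eqF// addr_gt0.
have e : 1 + (s + t) / 2 = (a + b) / 2 by rewrite /a /b; field.
rewrite e -/a -/b -subr_ge0.
have -> : a^-1 + b^-1 - (((a + b) / 2)^-1 + ((a + b) / 2)^-1 +
    (a^-1 - b^-1) ^+ 2 / 2) =
  (a - b) ^+ 2 / (2 * (a ^+ 2 * b ^+ 2 * (a + b))) *
    (2 * (a * b) - (a + b)) by field; rewrite a0 b0 ab0.
apply: mulr_ge0.
  by rewrite divr_ge0// ?sqr_ge0// !mulr_ge0// ?sqr_ge0// addr_ge0// ltW.
rewrite (_ : _ - _ = a * (b - 1) + b * (a - 1)); last by ring.
by rewrite addr_ge0// mulr_ge0// ?subr_ge0// ltW.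
Qed.

Lemma geometric_cvg (R : realType) (u : nat -> R) (C : R) :
  (forall k, `|u k.+1 - u k| <= C / 2 ^+ k) -> cvgn u.
Proof.
move=> H.
have : cvgn (series (telescope u)).
  apply: normed_cvg; apply: (@series_le_cvg _ _ (geometric C 2^-1)).
  - by move=> k /=; exact: normr_ge0.
  - by move=> k; rewrite /geometric /= exprVn; apply: le_trans (H k).
  - move=> k /=; rewrite /geometric /= exprVn; exact: H.
  - by apply: is_cvg_geometric_series; rewrite ger0_norm// invf_lt1// ltr1n.
move=> /cvg_ex[l ul]; apply/cvg_ex; exists (u 0%N + l).
have e : (fun k => u 0%N + series (telescope u) k) = u.
  by apply/funext => k; exact/esym/eq_sum_telescope.
by rewrite -[X in X @ _]e; apply: cvgD => //; exact: cvg_cst.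
Qed.

Section midpoint_ae_cvg.
Context d (T : measurableType d) (R : realType).
Variables (L : {measure set T -> \bar R}).
Hypothesis Loo : (L setT < +oo)%E.

Implicit Types u v : nat -> T -> R.

Let phi (t : R) : R := (1 + t)^-1.
Let wt (i : nat) : R := ((2 ^ i.+1)%:R)^-1.

Definition nnfam u := forall i, measurable_fun setT (u i) /\ (forall x, 0 <= u i x).

Let Phi u x := (\sum_(i <oo) (wt i * phi (u i x))%:E)%E.
(** A lower bound for the convexity defect of [Phi]. The weights have total 1, which keeps [Phi]
    below 1 and lets a single integral control all indices. *)
Let Dft u v x :=
  (\sum_(i <oo) (wt i * ((phi (u i x) - phi (v i x)) ^+ 2 / 2))%:E)%E.
Let mid u v : nat -> T -> R := fun i x => (u i x + v i x) / 2.

Let wt_gt0 i : 0 < wt i. Proof. by rewrite invr_gt0 ltr0n expn_gt0. Qed.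

Let phi_ge0 t : 0 <= t -> 0 <= phi t.
Proof. by move=> t0; rewrite invr_ge0 addr_ge0. Qed.

Let phi_le1 t : 0 <= t -> phi t <= 1.
Proof. by move=> t0; rewrite invf_le1 ?lerDl// ltr_pwDl. Qed.

Let Phi_le1 u x : nnfam u -> (Phi u x <= 1)%E.
Proof.
move=> nu; apply: (@le_trans _ _ (\sum_(i <oo) (1 / (2 ^ i.+1)%:R)%:E)%E); last first.
  exact: epsilon_trick0.
apply: lee_nneseries => i _; have [_ u0] := nu i.
  by rewrite lee_fin mulr_ge0// ?phi_ge0// ltW.
by rewrite lee_fin mulrC ler_wpM2r ?phi_le1// invr_ge0.
Qed.

Let Phi_ge0 u x : nnfam u -> (0 <= Phi u x)%E.
Proof.
move=> nu; apply: nneseries_ge0 => i _ _; have [_ u0] := nu i.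
by rewrite lee_fin mulr_ge0// ?phi_ge0// ltW.
Qed.

Let Dft_ge0 u v x : (0 <= Dft u v x)%E.
Proof.
apply: nneseries_ge0 => i _ _.
by rewrite lee_fin mulr_ge0// ?divr_ge0 ?sqr_ge0// ltW.
Qed.

Let nnfam_mid u v : nnfam u -> nnfam v -> nnfam (mid u v).
Proof.
move=> nu nv i; have [mu u0] := nu i; have [mv v0] := nv i; split.
  by apply: measurable_funM => //; exact: measurable_funD.
by move=> x; rewrite divr_ge0// addr_ge0.
Qed.

Let measurable_phi (h : T -> R) : measurable_fun setT h ->
  (forall x, 0 <= h x) -> measurable_fun setT (fun x => phi (h x)).
Proof.
move=> mh h0.
have -> : (fun x => phi (h x)) = fun x => (1 + h x) `^ (-1).
  apply/funext => x; rewrite /phi powRN powRr1// addr_ge0//.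
by apply: (measurableT_comp (measurable_powR _)); exact: measurable_funD.
Qed.

Let measurable_Phi u : nnfam u -> measurable_fun setT (Phi u).
Proof.
move=> nu; apply: ge0_emeasurable_sum.
  move=> i x _ _; have [_ u0] := nu i.
  by rewrite lee_fin mulr_ge0// ?phi_ge0// ltW.
move=> i _; have [mu u0] := nu i.
by apply/measurable_EFinP/measurable_funM => //; exact: measurable_phi.
Qed.

Let measurable_Dft u v : nnfam u -> nnfam v -> measurable_fun setT (Dft u v).
Proof.
move=> nu nv; apply: ge0_emeasurable_sum.
  by move=> i x _ _; rewrite lee_fin mulr_ge0// ?divr_ge0 ?sqr_ge0// ltW.
move=> i _; have [mu u0] := nu i; have [mv v0] := nv i.
apply/measurable_EFinP/measurable_funM => //; apply: measurable_funM => //.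
by apply: measurable_funX; apply: measurable_funB; exact: measurable_phi.
Qed.

Let wphi_ge0 u i x : nnfam u -> 0 <= wt i * phi (u i x).
Proof. by move=> nu; have [_ u0] := nu i; rewrite mulr_ge0// ?phi_ge0// ltW. Qed.

Let wsq_ge0 i a : 0 <= wt i * (a ^+ 2 / 2).
Proof. by rewrite mulr_ge0// ?divr_ge0 ?sqr_ge0// ltW. Qed.

Let Phi_mid u v x : nnfam u -> nnfam v ->
  (Phi (mid u v) x + Phi (mid u v) x + Dft u v x <= Phi u x + Phi v x)%E.
Proof.
move=> nu nv; have nm := nnfam_mid nu nv.
rewrite /Phi /Dft -!nneseriesD//; last first.
all: try by move=> i _; rewrite ?lee_fin ?addr_ge0// ?wphi_ge0.
apply: lee_nneseries => i _.
  by rewrite -!EFinD lee_fin !addr_ge0// wphi_ge0.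
rewrite -!EFinD lee_fin -!mulrDr ler_wpM2l//; first exact: ltW.
by apply: inv1D_midpoint; [have [_] := nu i|have [_] := nv i].
Qed.

Let J u : R := fine (\int[L]_x Phi u x).

Let JE u : nnfam u -> (\int[L]_x Phi u x = (J u)%:E)%E.
Proof.
move=> nu; rewrite /J fineK// ge0_fin_numE; last first.
  by apply: integral_ge0 => x _; exact: Phi_ge0.
apply: (@le_lt_trans _ _ (\int[L]_x (cst 1%E x))%E).
  apply: ge0_le_integral => //.
  - by move=> x _; exact: Phi_ge0.
  - exact: measurable_Phi.
  - by move=> x _; exact: Phi_le1.
by rewrite integral_cst// mul1e.
Qed.

Let J_ge0 u : nnfam u -> 0 <= J u.
Proof.
move=> nu; rewrite -lee_fin -JE//.
by apply: integral_ge0 => x _; exact: Phi_ge0.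
Qed.

Let J_le u : nnfam u -> J u <= fine (L setT).
Proof.
move=> nu; rewrite -lee_fin -JE// fineK ?ge0_fin_numE//.
rewrite -[leRHS]mul1e -integral_cst//; apply: ge0_le_integral => //.
- by move=> x _; exact: Phi_ge0.
- exact: measurable_Phi.
- by move=> x _; exact: Phi_le1.
Qed.

Let J_mid u v : nnfam u -> nnfam v ->
  (\int[L]_x Dft u v x <= (J u + J v - J (mid u v) *+ 2)%:E)%E.
Proof.
move=> nu nv; have nm := nnfam_mid nu nv.
rewrite EFinB mulr2n leeBrDl//.
have P0 y : nnfam y -> forall x, setT x -> (0 <= Phi y x)%E.
  by move=> ny x _; exact: Phi_ge0.
have mP := measurable_Phi.
have mPm : measurable_fun setT (fun x => Phi (mid u v) x + Phi (mid u v) x)%E.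
  by apply: emeasurable_funD; exact: mP.
have D0 : forall x, setT x -> (0 <= Dft u v x)%E by [].
have PP0 x : setT x -> (0 <= Phi (mid u v) x + Phi (mid u v) x)%E.
  by move=> Tx; rewrite adde_ge0// P0.
rewrite !EFinD -(JE nm) -(JE nu) -(JE nv).
rewrite -(ge0_integralD L measurableT (P0 _ nm) (mP _ nm) (P0 _ nm) (mP _ nm)).
rewrite -(ge0_integralD L measurableT PP0 mPm D0 (measurable_Dft nu nv)).
rewrite -(ge0_integralD L measurableT (P0 _ nu) (mP _ nu) (P0 _ nv) (mP _ nv)).
apply: ge0_le_integral => //.
- by move=> x Tx; rewrite adde_ge0// PP0.
- by apply: emeasurable_funD => //; exact: measurable_Dft.
- by apply: emeasurable_funD; exact: mP.
- by move=> x _; exact: Phi_mid.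
Qed.

Variables (w : nat -> nat -> T -> R) (B : nat -> R).
Hypothesis nw : forall m, nnfam (w m).
Hypothesis wB : forall m i, (\int[L]_x (w m i x)%:E <= (B i)%:E)%E.

Lemma nnfam_midhull k u : midhull w k u -> nnfam u.
Proof. by elim=> [m _|u1 u2 _ n1 _ n2]; [exact: nw|exact: nnfam_mid]. Qed.

Let midhull_bound k u i : midhull w k u -> (\int[L]_x (u i x)%:E <= (B i)%:E)%E.
Proof.
elim=> [m _|u1 u2 h1 IH1 h2 IH2]; first exact: wB.
have [m1 n1] := nnfam_midhull h1 i; have [m2 n2] := nnfam_midhull h2 i.
under eq_integral do rewrite EFinM EFinD.
have mD : measurable_fun setT (fun x => (u1 i x)%:E + (u2 i x)%:E)%E.
  by apply: emeasurable_funD; exact/measurable_EFinP.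
rewrite (@ge0_integralZr _ _ _ L _ measurableT _ mD)//; last first.
  by move=> x _; rewrite -EFinD lee_fin addr_ge0.
rewrite ge0_integralD//; [|by move=> x _; rewrite lee_fin|exact/measurable_EFinP|
  by move=> x _; rewrite lee_fin|exact/measurable_EFinP].
rewrite (_ : B i = (B i + B i) / 2); last by field.
by rewrite EFinM lee_wpmul2r ?lee_fin// EFinD leeD.
Qed.

(** The hulls shrink as [k] grows, so [j] increases; once it is close to its supremum [s], almost
    minimizers over different tails have almost equal values of [J]. *)
Let j k : R := inf [set J u | u in midhull w k].

Let j_lb k u : midhull w k u -> j k <= J u.
Proof.
move=> hu; apply: ge_inf; last by exists u.
by exists 0 => _ [v hv <-]; exact/J_ge0/nnfam_midhull/hv.
Qed.

Let j_adherent k e : 0 < e -> exists2 u, midhull w k u & J u < j k + e.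
Proof.
move=> e0.
have hinf : has_inf [set J u | u in midhull w k].
  split; first by exists (J (w k)); exists (w k) => //; exact: midhull_base.
  by exists 0 => _ [v hv <-]; exact/J_ge0/nnfam_midhull/hv.
by have [_ [u hu <-] Ju] := inf_adherent e0 hinf; exists u.
Qed.

Let j_le k : j k <= fine (L setT).
Proof.
by apply: le_trans (j_lb (midhull_base w (leqnn k))) _; exact: J_le.
Qed.

Let s := sup (range j).

Let j_s k : j k <= s.
Proof.
by apply: ub_le_sup; [exists (fine (L setT)) => _ [l _ <-]|exists k].
Qed.

Let near_s e : 0 < e -> exists k, s - e < j k.
Proof.
move=> e0.
have hs : has_sup (range j).
  by split; [exists (j 0%N); exists 0%N|exists (fine (L setT)) => _ [l _ <-]].
by have [_ [k _ <-]] := sup_adherent e0 hs; exists k.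
Qed.

Let j_nd k l : (k <= l)%N -> j k <= j l.
Proof.
move=> kl; apply: lb_le_inf; first by exists (J (w l)); exists (w l) => //; exact: midhull_base.
by move=> _ [u hu <-]; apply: j_lb; exact: midhull_le kl hu.
Qed.

(* A midpoint of two almost minimizers of [J] cannot do better than the
   infimum, so their convexity defect is small. *)
Let small_defects : exists v : nat -> nat -> T -> R,
  (forall l, midhull w l (v l)) /\
  (forall l, (\int[L]_x Dft (v l) (v l.+1) x <= (4 / 8 ^+ l)%:E)%E).
Proof.
(* The rate 8 leaves room: multiplied by [4 ^+ l] the defects are still summable, and the square
   root of [4 ^+ l] gives geometric decay of the increments. The factor 4 in the bound is one error
   for each of the two values of [J] and two for twice the midpoint. *)
have e0 l : 0 < (8 ^+ l)^-1 :> R by rewrite invr_gt0 exprn_gt0.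
have /choice[v Hv] : forall l, exists u, exists K,
    [/\ (l <= K)%N, midhull w K u, s - (8 ^+ l)^-1 < j K & J u < s + (8 ^+ l)^-1].
  move=> l; have [k hk] := near_s (e0 l).
  have [u hu Ju] := j_adherent (maxn k l) (e0 l).
  exists u, (maxn k l); split => //; first exact: leq_maxr.
    by apply: lt_le_trans hk _; apply: j_nd; exact: leq_maxl.
  by apply: lt_le_trans Ju _; rewrite lerD2r.
exists v; split=> [l|l].
  by have [K [lK hK _ _]] := Hv l; exact: midhull_le lK hK.
have [K [_ hK sK JK]] := Hv l; have [K' [_ hK' sK' JK']] := Hv l.+1.
have e1 : (8 ^+ l.+1)^-1 <= (8 ^+ l)^-1 :> R.
  by rewrite lef_pV2 ?posrE ?exprn_gt0// ler_weXn2l// ler1n.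
have nl := nnfam_midhull hK; have nl' := nnfam_midhull hK'.
apply: le_trans (J_mid nl nl') _.
have hm : midhull w (minn K K') (mid (v l) (v l.+1)).
  apply: midhull_mid.
    by apply: midhull_le hK; exact: geq_minl.
  by apply: midhull_le hK'; exact: geq_minr.
have jm := j_lb hm.
have sm : s - (8 ^+ l)^-1 < j (minn K K').
  rewrite /minn; case: ifP => _ //; apply: le_lt_trans sK'.
  by rewrite lerB.
rewrite lee_fin mulr2n; move: e1 jm sm JK JK' sK sK'.
set a := (8 ^+ l)^-1; set b := (8 ^+ l.+1)^-1; set Jm := J _.
set J1 := J _; set J2 := J _; set jj := j _; set j1 := j _; set j2 := j _.
by move=> *; lra.
Qed.

Let Dft_term u v i x : ((wt i * ((phi (u i x) - phi (v i x)) ^+ 2 / 2))%:E <=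
  Dft u v x)%E.
Proof.
rewrite /Dft (nneseriesD1 (n := i))//; last by move=> k _; rewrite lee_fin.
rewrite leeDl//; apply: nneseries_ge0 => k _ _.
by rewrite lee_fin.
Qed.

(** Summable defects make [phi (v l i x)] converge geometrically for almost every [x]. Since [phi]
    vanishes only at infinity, [v l i x] itself converges unless it tends to infinity, which the
    integral bounds [B i] exclude almost everywhere. *)
Lemma midpoint_ae_cvg : exists v : nat -> nat -> T -> R, exists vl : nat -> T -> R,
  [/\ forall l, midhull w l (v l), nnfam vl &
      {ae L, forall x i, v l i x @[l --> \oo] --> vl i x}].
Proof.
have [v [hv Dv]] := small_defects.
have nv l : nnfam (v l) by exact: nnfam_midhull (hv l).
(* The lower limit is measurable on the whole space and agrees with the limit wherever there is
   one. *)
pose vi i x := limn_einf (fun l => (v l i x)%:E).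
have mvi i : measurable_fun setT (vi i).
  apply: measurableT_comp => //; apply: measurable_fun_limn_esup => l.
  by apply: measurableT_comp => //; have [m _] := nv l i; exact/measurable_EFinP.
have vi0 i x : (0 <= vi i x)%E.
  apply: limn_einf_ge => a a0; apply: nearW => l; apply: le_trans (ltW a0) _.
  by have [_ n] := nv l i; rewrite lee_fin.
exists v, (fun i x => fine (vi i x)); split => //.
  move=> i; split; first exact: measurableT_comp.
  by move=> x; rewrite fine_ge0.
have fin_vi : {ae L, forall x i, vi i x \is a fin_num}.
  apply/ae_foralln => i.
  have : L.-integrable setT (vi i).
    apply/integrableP; split => //.
    apply: (@le_lt_trans _ _ (B i)%:E); last exact: ltry.
    under eq_integral do rewrite gee0_abs//.
    apply: (@fatou_bound _ _ _ L (fun l x => (v l i x)%:E)) => //.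
    - by move=> l; have [m _] := nv l i; exact/measurable_EFinP.
    - by move=> l x; have [_ n] := nv l i; rewrite lee_fin.
    - by apply: aeW => x a; exact: lt_limn_einf.
    - move=> e e0; apply: nearW => l; apply: le_trans (midhull_bound i (hv l)) _.
      by rewrite lee_fin lerDl ltW.
  by move=> /(integrable_ae measurableT); apply: filterS => x; exact.
have fin_sum : {ae L, forall x,
    (\sum_(l <oo) (4 ^+ l)%:E * Dft (v l) (v l.+1) x)%E \is a fin_num}.
  pose S x := (\sum_(l <oo) (4 ^+ l)%:E * Dft (v l) (v l.+1) x)%E.
  have t0 l x : (0 <= (4 ^+ l)%:E * Dft (v l) (v l.+1) x)%E.
    by rewrite mule_ge0// lee_fin exprn_ge0.
  have mt l : measurable_fun setT (fun x => (4 ^+ l)%:E * Dft (v l) (v l.+1) x)%E.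
    by apply: emeasurable_funM => //; exact: measurable_Dft.
  have S0 x : (0 <= S x)%E by apply: nneseries_ge0 => l _ _; exact: t0.
  have : L.-integrable setT S.
    apply/integrableP; split.
      by apply: ge0_emeasurable_sum => // l x _ _; exact: t0.
    under eq_integral do rewrite gee0_abs//.
    rewrite integral_nneseries//.
    apply: (@le_lt_trans _ _ 8%:E); last exact: ltry.
    (* Here [4 ^+ l] times the defect bound [4 / 8 ^+ l] equals [8 / 2 ^ l.+1]. *)
    apply: (@le_trans _ _ (\sum_(i <oo) (8 / (2 ^ i.+1)%:R)%:E)%E); last first.
      exact: epsilon_trick0.
    apply: lee_nneseries => l _.
      by move=> _; apply: integral_ge0 => x _; exact: t0.
    rewrite (ge0_integralZl L measurableT (measurable_Dft (nv l) (nv l.+1)))//.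
    apply: (@le_trans _ _ ((4 ^+ l)%:E * (4 / 8 ^+ l)%:E)%E).
      by rewrite lee_wpmul2l// lee_fin exprn_ge0.
    rewrite -EFinM lee_fin natrX exprS (_ : 8 = 4 * 2 :> R); last by rewrite -natrM.
    rewrite exprMn le_eqVlt; apply/orP; left; apply/eqP; field.
    by rewrite !expf_neq0.
  by move=> /(integrable_ae measurableT); apply: filterS => x; exact.
apply: filterS2 fin_vi fin_sum => x fx Sx i.
pose C := fine (\sum_(l <oo) (4 ^+ l)%:E * Dft (v l) (v l.+1) x)%E.
have DC l : 4 ^+ l * (wt i * ((phi (v l i x) - phi (v l.+1 i x)) ^+ 2 / 2)) <= C.
  rewrite -lee_fin fineK// EFinM.
  apply: (@le_trans _ _ ((4 ^+ l)%:E * Dft (v l) (v l.+1) x)%E).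
    by rewrite lee_wpmul2l ?lee_fin ?exprn_ge0//; exact: Dft_term.
  rewrite (nneseriesD1 (n := l))//; last first.
    by move=> k _; rewrite mule_ge0// lee_fin exprn_ge0.
  rewrite leeDl//; apply: nneseries_ge0 => k _ _.
  by rewrite mule_ge0// lee_fin exprn_ge0.
have C0 : 0 <= C.
  by apply: le_trans (DC 0%N); rewrite mulr_ge0 ?exprn_ge0.
have cphi : cvgn (fun l => phi (v l i x)).
  (* The constant comes from solving [DC l] for the difference of the two values of [phi]. *)
  apply: (@geometric_cvg _ _ (Num.sqrt (C * 2 / wt i))) => l.
  rewrite -sqrtr_sqr -[X in _ / X]ger0_norm ?exprn_ge0// -sqrtr_sqr -sqrtrV ?sqr_ge0//.
  rewrite -sqrtrM; last by rewrite divr_ge0// ?mulr_ge0// ltW.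
  rewrite ler_sqrt; last first.
    by rewrite mulr_ge0// ?invr_ge0 ?sqr_ge0// divr_ge0// ?mulr_ge0// ltW.
  rewrite ler_pdivlMr ?exprn_gt0// ler_pdivlMr// -exprM mulnC exprM.
  rewrite (_ : 2 ^+ 2 = 4 :> R); last by rewrite -natrX.
  rewrite -ler_pdivrMr//; apply: le_trans (DC l).
  rewrite le_eqVlt; apply/orP; left; apply/eqP.
  by ring.
move: cphi => /cvg_ex[b phib].
have vphi l : v l i x = (phi (v l i x))^-1 - 1 by rewrite /phi invrK addrC addKr.
suff [r vr] : exists r : R, v l i x @[l --> \oo] --> r.
  suff -> : vi i x = r%:E by [].
  rewrite /vi is_cvg_limn_einfE; last first.
    by apply/cvg_ex; exists r%:E; apply: cvg_EFin => //; exact: nearW.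
  by apply/cvg_lim => //; apply: cvg_EFin => //; exact: nearW.
have b0 : 0 <= b.
  move/cvgP : (phib) => cphi; rewrite -(cvg_lim (@Rhausdorff R) phib).
  by apply: limr_ge => //; apply: nearW => l; apply: phi_ge0; have [_] := nv l i.
move: b0; rewrite le_eqVlt => /predU1P[b0|b0]; last first.
  exists (b^-1 - 1); under eq_fun do rewrite vphi.
  apply: cvgB; last exact: cvg_cst.
  by apply: cvgV => //; rewrite gt_eqF.
(* If [phi (v l i x)] tended to 0, the values [v l i x] would exceed every bound, against the
   finiteness of their lower limit. *)
exfalso; move: (fx i); rewrite (_ : vi i x = +oo%E)//.
apply/eqP; rewrite -leye_eq; apply: limn_einf_ge => a _.
have a1 : 0 < (1 + `|a|)^-1 by rewrite invr_gt0 ltr_pwDl.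
move/cvgrPdist_lt : phib => /(_ _ a1); apply: filterS => l.
have [_ n] := nv l i.
have pa : 1 + `|a| \is Num.pos by rewrite posrE ltr_pwDl.
have pv : 1 + v l i x \is Num.pos by rewrite posrE ltr_pwDl.
rewrite -b0 sub0r normrN ger0_norm ?phi_ge0// /phi ltf_pV2//.
by rewrite ltrD2l lee_fin => /ltW; apply: le_trans; exact: ler_norm.
Qed.

End midpoint_ae_cvg.

(** * Greedy enumeration of the atoms *)

(* Each new atom has at least half of the largest remaining mass, so the [i]-th
   one weighs at most [2 / i.+1]. *)
Section greedy_enumeration.
Variables (T : choiceType) (R : realType) (m : T -> R).
Hypothesis sum_m : forall s : seq T, uniq s -> \sum_(x <- s) m x <= 1.

Let pick_near_max (s : seq T) : exists o : option T,
  if o is Some y then [/\ y \notin s, 0 < m y & forall z, z \notin s -> m z <= 2 * m y]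
  else forall z, z \notin s -> m z <= 0.
Proof.
have [[z0 [zs z0p]]|H] := pselect (exists z, z \notin s /\ 0 < m z); last first.
  exists None => z zs; rewrite leNgt; apply/negP => mz; apply: H; by exists z.
pose S := [set m z | z in [set z | z \notin s]].
have ubS : has_ubound S.
  exists 1 => _ [z _ <-]; have := sum_m (s := [:: z]) isT.
  by rewrite big_seq1.
have supS : has_sup S by split => //; exists (m z0); exists z0.
have z0sup : m z0 <= sup S by apply: ub_le_sup => //; exists z0.
have sup0 : 0 < sup S by apply: lt_le_trans z0sup.
have [_ [y ys <-] hy] := sup_adherent (divr_gt0 sup0 (ltr0Sn R 1)) supS.
exists (Some y); split => //; first by lra.
move=> z zs'; apply: (@le_trans _ _ (sup S)); last by lra.
by apply: ub_le_sup => //; exists z.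
Qed.

Lemma greedy_enumeration : exists e : nat -> option T,
  [/\ forall i j x, e i = Some x -> e j = Some x -> i = j,
      forall x, 0 < m x -> exists i, e i = Some x &
      forall i x, e i = Some x -> 0 < m x /\ m x * i.+1%:R <= 2].
Proof.
have [pk Hpk] := choice pick_near_max.
pose step s := if pk s is Some y then y :: s else s.
pose st i := iter i step [::].
have stS i : st i.+1 = step (st i) by [].
have inv i : [/\ uniq (st i), size (st i) = i \/ pk (st i) = None &
    forall y z, y \in st i -> z \notin st i -> m z <= 2 * m y].
  elim: i => [|i [us ss hs]]; first by split => //; left.
  rewrite stS /step; case E : (pk (st i)) => [y|].
    have := Hpk (st i); rewrite E => -[yn y0 hy]; split.
    - by rewrite /= yn.
    - by left => /=; case: ss => [->|]; rewrite // E.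
    - move=> y' z; rewrite !inE negb_or => /predU1P[->|y's] /andP[_ zs].
        exact: hy.
      exact: hs.
  by split => //; right.
have sub i j : (i <= j)%N -> {subset st i <= st j}.
  move=> /subnK <-; elim: (j - i)%N => // k IH x /IH xk.
  by rewrite addSn stS /step; case: (pk _) => // y; rewrite inE xk orbT.
(* The [i] chosen points weigh at least [m x / 2] each and at most 1 together. *)
have bound i x : size (st i) = i -> x \notin st i -> m x * i%:R <= 2.
  move=> si xs; have [us _ hs] := inv i.
  have := sum_m us.
  have : \sum_(y <- st i) (m x / 2) <= \sum_(y <- st i) m y.
    rewrite big_seq [leRHS]big_seq; apply: ler_sum => y ys.
    by rewrite ler_pdivrMr// mulrC; exact: hs.
  rewrite big_const_seq count_predT iter_addr_0 si -mulr_natr.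
  by move=> h1 h2; have := le_trans h1 h2; lra.
exists (fun i => pk (st i)); split.
- have aux i j x : (i < j)%N -> pk (st i) = Some x -> pk (st j) = Some x -> False.
    move=> ij Ei Ej; have := Hpk (st j); rewrite Ej => -[/negP xn _ _]; apply: xn.
    by apply: (sub _ _ ij); rewrite stS /step Ei mem_head.
  move=> i j x Ei Ej; have [ij|ji|//] := ltngtP i j.
    by case: (aux _ _ _ ij Ei Ej).
  by case: (aux _ _ _ ji Ej Ei).
(* A point of positive mass that is never chosen keeps the list growing, and [bound] fails once [i]
   exceeds [2 / m x]. *)
- move=> x x0; apply/not_existsP => H.
  have xn i : x \notin st i.
    elim: i => [//|i IH]; rewrite stS /step; case E : (pk (st i)) => [y|//].
    rewrite inE negb_or IH andbT; apply/negP => /eqP yx.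
    by apply: (H i); rewrite E yx.
  have si i : size (st i) = i.
    have [_ [//|E] _] := inv i; have := Hpk (st i); rewrite E => /(_ x (xn i)).
    by rewrite leNgt x0.
  pose N := Num.truncn (2 / m x).
  have := bound N.+1 x (si _) (xn _); rewrite leNgt => /negP; apply.
  by rewrite mulrC -ltr_pdivrMr//; exact: truncnS_gt.
- move=> i x E; have := Hpk (st i); rewrite E => -[xn x0 hx]; split => //.
  have [us [si|]] := inv i; last by rewrite E.
  move=> hs.
  (* Counting the new point as well gives [i.+1] points of mass at least [m x / 2]. *)
  have : \sum_(y <- x :: st i) m y <= 1 by apply: sum_m; rewrite /= xn.
  have : \sum_(y <- x :: st i) (m x / 2) <= \sum_(y <- x :: st i) m y.
    rewrite big_seq [leRHS]big_seq; apply: ler_sum => y; rewrite inE => ys.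
    rewrite ler_pdivrMr// mulrC; move: ys => /predU1P[->|ys]; last exact: hs.
    by lra.
  rewrite big_const_seq count_predT iter_addr_0 /= si -[_ *+ _.+1]mulr_natr.
  by move=> h1 h2; have := le_trans h1 h2; lra.
Qed.

End greedy_enumeration.

(** * Simultaneous subsequences by an ultrafilter *)

Lemma ultra_fmap (T S : Type) (h : T -> S) (U : set_system T) :
  UltraFilter U -> UltraFilter (h @ U).
Proof.
move=> UU; split; first exact: fmap_proper_filter.
move=> G GF sG; rewrite predeqE => A; split; last exact: sG.
move=> GA; have [//|UC] := in_ultra_setVsetC (h @^-1` A) UU.
by have /sG GC : (h @ U) (~` A) by []; have [x []] := filter_ex (filterI GA GC).
Qed.

(** An ultrafilter finer than [\oo] replaces the diagonal extraction: all coordinates converge along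
    it at once. Step [k] then picks an index where the coordinates with code at most [k] are within
    [k.+1%:R^-1] of their limits. The map [ph] need not be monotone; [k <= ph k] is enough. *)
Lemma cvg_subseq_family (R : realType) (J : countType) (u : nat -> J -> R)
    (B : J -> R) : (forall k j, `|u k j| <= B j) ->
  exists ph : nat -> nat, exists l : J -> R,
    (forall k, (k <= ph k)%N) /\ (forall j, u (ph k) j @[k --> \oo] --> l j).
Proof.
move=> uB.
have [U [UU sU]] := ultraFilterLemma eventually_filter.
have /choice[l ul] : forall j : J, exists l : R, u ^~ j @ U --> l.
  move=> j; have := @segment_compact R (- B j) (B j).
  have UI : UltraFilter (u ^~ j @ U) by exact: ultra_fmap.
  rewrite compact_ultra => /(_ _ UI)[|l [_ ul]]; last by exists l.
  rewrite /fmap /=; apply: (@filterS _ U _ setT); last exact: filterT.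
  by move=> k _ /=; rewrite in_itv /= -ler_norml; exact: uB.
pose P k (n : nat) := (k <= n)%N /\
  forall i : 'I_k.+1, forall j, pickle j = i -> `|l j - u n j| < k.+1%:R^-1.
have /choice[ph Hph] : forall k, exists n, P k n.
  move=> k; apply: (@filter_ex _ U); apply: filterI.
    by apply: sU; exact: nbhs_infty_ge.
  apply: filter_forall => i.
  have [[j ji]|H] := pselect (exists j : J, pickle j = i); last first.
    by apply: filterS filterT => n _ j ji; case: H; exists j.
  have k0 : 0 < k.+1%:R^-1 :> R by rewrite invr_gt0.
  have := ul j; move/cvgrPdist_lt => /(_ _ k0); apply: filterS => n ln j' j'i.
  suff -> : j' = j by exact: ln.
  by apply: (pcan_inj pickleK); rewrite ji j'i.
exists ph, l; split=> [k|j]; first by have [] := Hph k.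
apply/cvgrPdist_lt => e e0; near=> k.
have jk : (pickle j < k.+1)%N by rewrite ltnS; near: k; exact: nbhs_infty_ge.
have [_ /(_ (Ordinal jk) j erefl) H] := Hph k; apply: lt_trans H _.
by near: k; exact: near_infty_natSinv_lt (PosNum e0).
Unshelve. all: by end_near. Qed.

(** * Limits of densities under convex bounds *)

Section convex_limit.
Context d (T : measurableType d) (R : realType).
Variables (L : {measure set T -> \bar R}).
Hypothesis Loo : (L setT < +oo)%E.
Variable (w : nat -> nat -> T -> R).
Hypothesis nw : forall m, nnfam (w m).

(** Midpoint convexity carries the bound from the sequence to its hull, and lower semicontinuity
    with Fatou's lemma carries it on to the limit. The integrand receives the whole family [y], so
    that functions of several indices fit. *)
Lemma convex_fatou (v : nat -> nat -> T -> R) (vl : nat -> T -> R)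
    (G : T -> (nat -> R) -> \bar R) (B : R) :
  (forall l, midhull w l (v l)) -> nnfam vl ->
  {ae L, forall x i, v l i x @[l --> \oo] --> vl i x} ->
  (forall x (y : nat -> R), (forall i, 0 <= y i) -> (0 <= G x y)%E) ->
  (forall x (y z : nat -> R), (forall i, 0 <= y i) -> (forall i, 0 <= z i) ->
    (G x (fun i => (y i + z i) / 2)%R <= (G x y + G x z) * (2^-1)%:E)%E) ->
  (forall x (z : nat -> nat -> R) y, (forall i, z l i @[l --> \oo] --> y i) ->
    forall a : R, (a%:E < G x y)%E -> \forall l \near \oo, (a%:E <= G x (z l))%E) ->
  (forall u : nat -> T -> R, nnfam u -> measurable_fun setT (fun x => G x (u ^~ x))) ->
  (forall e : R, 0 < e -> \forall m \near \oo,
    (\int[L]_x G x (w m ^~ x) <= (B + e)%:E)%E) ->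
  (\int[L]_x G x (vl ^~ x) <= B%:E)%E.
Proof.
move=> hv nvl vvl G0 Gmid Glsc mG wB.
have nnv l : nnfam (v l) by exact: nnfam_midhull (hv l).
have nn0 (u : nat -> T -> R) x : nnfam u -> forall i, 0 <= u i x.
  by move=> nu i; have [_] := nu i.
apply: (@fatou_bound _ _ _ L (fun l x => G x (v l ^~ x))).
- by move=> l; exact: mG.
- by move=> l x; apply: G0; exact: nn0.
- exact: mG.
- by move=> x; apply: G0; exact: nn0.
- by apply: filterS vvl => x Hx a; exact: Glsc.
move=> e e0.
pose P u := nnfam u /\ (\int[L]_x G x (u ^~ x) <= (B + e)%:E)%E.
suff : \forall k \near \oo, forall u, midhull w k u -> P u.
  by apply: filterS => k /(_ _ (hv k))[].
apply: midhull_near; last by apply: filterS (wB e e0) => m; split.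
move=> u1 u2 [n1 I1] [n2 I2].
have nm : nnfam (fun i x => (u1 i x + u2 i x) / 2).
  move=> i; have [m1 p1] := n1 i; have [m2 p2] := n2 i; split.
    by apply: measurable_funM => //; exact: measurable_funD.
  by move=> x; rewrite divr_ge0// addr_ge0.
split=> //.
apply: (@le_trans _ _
    (\int[L]_x ((G x (u1 ^~ x) + G x (u2 ^~ x)) * (2^-1)%:E))%E).
  apply: ge0_le_integral => //.
  - by move=> x _; apply: G0; exact: (nn0 _ x nm).
  - exact: mG nm.
  - apply: emeasurable_funM => //.
    by apply: emeasurable_funD; exact: mG.
  - by move=> x _; apply: Gmid; exact: nn0.
have mD : measurable_fun setT (fun x => G x (u1 ^~ x) + G x (u2 ^~ x))%E.
  by apply: emeasurable_funD; exact: mG.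
rewrite (@ge0_integralZr _ _ _ L _ measurableT _ mD)//; last first.
  by move=> x _; apply: adde_ge0; apply: G0; exact: nn0.
rewrite ge0_integralD//; last 4 first.
- by move=> x _; apply: G0; exact: nn0.
- exact: mG.
- by move=> x _; apply: G0; exact: nn0.
- exact: mG.
rewrite (_ : B + e = ((B + e) + (B + e)) / 2); last by field.
by rewrite EFinM lee_wpmul2r ?lee_fin// EFinD leeD.
Qed.

Variables (h : R -> \bar R) (al : nat -> R) (c : nat -> T -> R) (F C : R).
Hypothesis h0 : forall t, (0 <= h t)%E.
Hypothesis h_nd : forall s t, s <= t -> (h s <= h t)%E.
Hypothesis h_lsc : lower_semicontinuous h.
Hypothesis h_mid : forall s t, 0 <= s -> 0 <= t ->
  (h ((s + t) / 2)%R <= (h s + h t) * (2^-1)%:E)%E.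
Hypothesis h_superlinear : forall M, 0 < M ->
  exists2 t0, 0 <= t0 & forall t, t0 <= t -> ((M * t)%:E <= h t)%E.
Hypothesis c0 : forall i, measurable_fun setT (c i) /\ (forall x, 0 <= c i x).
Hypothesis w_le1 : forall m i, (\int[L]_x (w m i x)%:E <= 1)%E.
Hypothesis w_mass : forall i (e : R), 0 < e -> \forall m \near \oo,
  ((al i - e)%:E <= \int[L]_x (w m i x)%:E <= (al i + e)%:E)%E.
Hypothesis al_sum : (\sum_(i <oo) (al i)%:E < +oo)%E.
Hypothesis w_F : forall N (e : R), 0 < e -> \forall m \near \oo,
  (\int[L]_x h (\sum_(i < N) w m i x) <= (F + e)%:E)%E.
Hypothesis w_C : forall N (e : R), 0 < e -> \forall m \near \oo,
  (\int[L]_x (\sum_(i < N) c i x * w m i x)%:E <= (C + e)%:E)%E.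

Let mh : measurable_fun setT h. Proof. exact: lower_semicontinuous_measurable. Qed.

Let nnfam_sum (u : nat -> T -> R) N : nnfam u ->
  measurable_fun setT (fun x => \sum_(i < N) u i x) /\
  forall x, 0 <= \sum_(i < N) u i x.
Proof.
move=> nu; split=> [|x]; last by apply: sumr_ge0 => i _; have [_] := nu i.
by apply: measurable_sum => i; have [] := nu i.
Qed.

Lemma convex_limit : exists v : nat -> T -> R, exists u : T -> R,
  [/\ nnfam v, forall i, (\int[L]_x (v i x)%:E = (al i)%:E)%E,
      [/\ measurable_fun setT u, forall x, 0 <= u x &
        {ae L, forall x, (\sum_(i <oo) (v i x)%:E = (u x)%:E)%E}],
      (\int[L]_x h (u x) <= F%:E)%E &
      (\sum_(i <oo) \int[L]_x (c i x * v i x)%:E <= C%:E)%E].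
Proof.
have [v [vl [hv nvl vvl]]] := midpoint_ae_cvg Loo nw w_le1.
have vl0 i x : 0 <= vl i x by have [_] := nvl i.
have mvl i : measurable_fun setT (vl i) by have [] := nvl i.
have EFin_lsc (z : nat -> R) y : z l @[l --> \oo] --> y ->
    forall a : R, (a%:E < y%:E)%E -> \forall l \near \oo, (a%:E <= (z l)%:E)%E.
  move=> zy a; rewrite lte_fin => ay.
  have H : \forall l \near \oo, a < z l by apply: (cvgr_gt y zy).
  by apply: filterS H => l /ltW la; rewrite lee_fin.
(* Convergence is known index by index, so it passes through finite sums only; the full sum [u] is
   reached at the end by a second use of Fatou's lemma, in [N]. *)
have FN N : (\int[L]_x h (\sum_(i < N) vl i x) <= F%:E)%E.
  apply: (convex_fatou (G := fun=> fun y => h (\sum_(i < N) y i))) hv nvl vvl _ _ _ _ (w_F N).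
  - by [].
  - move=> _ y z y0 z0; rewrite -mulr_suml big_split; apply: h_mid;
    by apply: sumr_ge0.
  - move=> _ z y zy a ah; have [V nV HV] := h_lsc ah.
    have zyN : \sum_(i < N) z l i @[l --> \oo] --> \sum_(i < N) y i.
      by apply: cvg_big => [|i _]; [exact: add_continuous|exact: zy].
    have H : \forall l \near \oo, V (\sum_(i < N) z l i) by exact: zyN nV.
    by apply: filterS H => l /HV /ltW.
  - by move=> u nu; apply: measurableT_comp => //; have [] := nnfam_sum N nu.
have upper i : (\int[L]_x (vl i x)%:E <= (al i)%:E)%E.
  apply: (convex_fatou (G := fun=> fun y => (y i)%:E)) hv nvl vvl _ _ _ _ _.
  - by move=> _ y y0; rewrite lee_fin.
  - by move=> _ y z y0 z0; rewrite -EFinD -EFinM.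
  - by move=> _ z y zy; exact: EFin_lsc.
  - by move=> u nu; have [m _] := nu i; exact/measurable_EFinP.
  - by move=> e e0; apply: filterS (w_mass i e0) => m /andP[].
have lower i : ((al i)%:E <= \int[L]_x (vl i x)%:E)%E.
  have Ivl : (\int[L]_x (vl i x)%:E \is a fin_num)%E.
    rewrite ge0_fin_numE; first by apply: le_lt_trans (upper i) _; exact: ltry.
    by apply: integral_ge0 => x _; rewrite lee_fin.
  rewrite -(fineK Ivl) lee_fin; apply/ler_addgt0Pr => e e0.
  set I := fine _.
  (* [F1] is a positive bound for the integrals of [h] at all large [m]. With the slope [F1 / e],
     their contribution divided by the slope is exactly [e]. *)
  pose F1 := `|F| + 1.
  have F10 : 0 < F1 by rewrite ltr_pwDr.
  have [t0 t00 Ht0] := h_superlinear (divr_gt0 F10 e0).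
  set M := F1 / e in Ht0.
  have M0 : 0 < M by rewrite divr_gt0.
  set L0 := fine (L setT).
  have L0E : L setT = L0%:E by rewrite /L0 fineK// ge0_fin_numE.
  have mmax (u : nat -> T -> R) : nnfam u ->
      measurable_fun setT (fun x => Num.max (t0 - u i x) 0).
    move=> nu; have [mu _] := nu i.
    by apply: measurable_maxr => //; exact: measurable_funB.
  have max0 t : 0 <= Num.max (t0 - t) 0 by rewrite le_max lexx orbT.
  (* Uniform integrability in a form Fatou can use: [M t0 + h t] dominates
     [M t + M * Num.max (t0 - t) 0], so no mass escapes to large values. *)
  have key : (\int[L]_x (Num.max (t0 - vl i x) 0)%:E <= (t0 * L0 + e - al i)%:E)%E.
    apply: (convex_fatou (G := fun=> fun y => (Num.max (t0 - y i) 0)%:E)) hv nvl vvl _ _ _ _ _.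
    - by move=> _ y y0; rewrite lee_fin.
    - move=> _ y z y0 z0; rewrite -EFinD -EFinM lee_fin ge_max.
      have maxl t : t0 - t <= Num.max (t0 - t) 0 by rewrite le_max lexx.
      have := maxl (y i); have := maxl (z i).
      have := max0 (y i); have := max0 (z i).
      set a := Num.max _ _; set b := Num.max _ _ => *.
      by apply/andP; split; lra.
    - move=> _ z y zy a; rewrite lte_fin lt_max => /orP[ay|a0]; last first.
        by apply: nearW => l; rewrite lee_fin le_max (ltW a0) orbT.
      have zy' : t0 - z l i @[l --> \oo] --> t0 - y i.
        by apply: cvgB => //; exact: cvg_cst.
      have H : \forall l \near \oo, a < t0 - z l i by apply: (cvgr_gt _ zy').
      by apply: filterS H => l /ltW la; rewrite lee_fin le_max la.
    - by move=> u nu; exact/measurable_EFinP/mmax.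
    move=> e' e'0.
    (* The first [i.+1] summands include the one of index [i], so monotonicity of [h] bounds the
       integral of [h (w m i x)]. *)
    have := w_mass i e'0; have := w_F i.+1 ltr01.
    apply: filterS2 => m Fm /andP[mlow _].
    have [mw0 w0] := nw m i.
    have Ffin : (\int[L]_x h (w m i x) <= F1%:E)%E.
      apply: (@le_trans _ _ (F + 1)%:E); last by rewrite lee_fin lerD2r ler_norm.
      apply: le_trans Fm; apply: ge0_le_integral => //.
      - exact: measurableT_comp.
      - by apply: measurableT_comp => //; have [] := nnfam_sum i.+1 (nw m).
      - move=> x _; apply: h_nd; rewrite big_ord_recr /= lerDr.
        by have [_] := nnfam_sum i (nw m); exact.
    have pw : (\int[L]_x ((M * w m i x)%:E + (M * Num.max (t0 - w m i x) 0)%:E) <=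
               \int[L]_x ((M * t0)%:E + h (w m i x)))%E.
      apply: ge0_le_integral => //.
      - by move=> x _; rewrite -EFinD lee_fin addr_ge0// mulr_ge0// ltW.
      - apply: emeasurable_funD; apply/measurable_EFinP/measurable_funM => //.
        exact: mmax.
      - by apply: emeasurable_funD => //; exact: measurableT_comp.
      move=> x _; rewrite -EFinD -mulrDr.
      have [tw|wt] := leP t0 (w m i x).
        rewrite (max_r _) ?subr_le0// addr0.
        apply: (@le_trans _ _ (h (w m i x))); first exact: Ht0.
        by rewrite leeDr// lee_fin mulr_ge0// ltW.
      rewrite max_l; last by rewrite subr_ge0 ltW.
      by rewrite (addrC (w m i x)) subrK leeDl.
    move: pw; rewrite ge0_integralD//; last 4 first.
    - by move=> x _; rewrite lee_fin mulr_ge0// ltW.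
    - exact/measurable_EFinP/measurable_funM.
    - by move=> x _; rewrite lee_fin mulr_ge0// ltW.
    - by apply/measurable_EFinP/measurable_funM => //; exact: mmax.
    rewrite ge0_integralD//; last 2 first.
    - by move=> x _; rewrite lee_fin mulr_ge0// ltW.
    - exact: measurableT_comp.
    rewrite integral_cst// L0E -EFinM.
    under eq_integral do rewrite EFinM.
    under [X in (_ + X <= _)%E -> _]eq_integral do rewrite EFinM.
    rewrite ge0_integralZl//; last 3 first.
    - exact/measurable_EFinP.
    - by move=> x _; rewrite lee_fin.
    - by rewrite lee_fin ltW.
    rewrite ge0_integralZl//; last 3 first.
    - by apply/measurable_EFinP; exact: mmax.
    - by move=> x _; rewrite lee_fin.
    - by rewrite lee_fin ltW.
    have X0 : (0 <= \int[L]_x (Num.max (t0 - w m i x) 0)%:E)%E.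
      by apply: integral_ge0 => x _; rewrite lee_fin.
    have W0 : (0 <= \int[L]_x (w m i x)%:E)%E.
      by apply: integral_ge0 => x _; rewrite lee_fin.
    have H0 : (0 <= \int[L]_x h (w m i x))%E by exact: integral_ge0.
    have eM : F1 = M * e by rewrite /M divfK// gt_eqF.
    move: X0 W0 H0 mlow (w_le1 m i) Ffin; rewrite eM.
    set X := (\int[L]_x (Num.max (t0 - w m i x) 0)%:E)%E.
    set W := (\int[L]_x (w m i x)%:E)%E.
    set H := (\int[L]_x h (w m i x))%E.
    case: H => [H| |]//; case: W => [W| |]//; case: X => [X| |]//; last first.
      by rewrite gt0_muley ?lte_fin// => *; rewrite -EFinM addey in *.
    rewrite -!EFinM -!EFinD !lee_fin => X0 W0 H0 aW _ HF.
    move=> Hle; rewrite -(ler_pM2l M0).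
    have := ler_wpM2l (ltW M0) aW; nra.
  (* Integrating [t0 <= t + Num.max (t0 - t) 0] along the limit turns the upper bound [key] into the
     lower bound for the mass. *)
  have : (\int[L]_x t0%:E <= \int[L]_x ((vl i x)%:E + (Num.max (t0 - vl i x) 0)%:E))%E.
    apply: ge0_le_integral => //.
    - by apply: emeasurable_funD; apply/measurable_EFinP => //; exact: mmax.
    - move=> x _; rewrite -EFinD lee_fin -lerBlDl.
      by rewrite le_max lexx.
  rewrite integral_cst// L0E ge0_integralD//; last 4 first.
  - by move=> x _; rewrite lee_fin.
  - exact/measurable_EFinP.
  - by move=> x _; rewrite lee_fin.
  - by apply/measurable_EFinP; exact: mmax.
  rewrite -(fineK Ivl) -/I => H.
  have : ((t0 * L0)%:E <= I%:E + (t0 * L0 + e - al i)%:E)%E.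
    by rewrite EFinM; apply: le_trans H _; rewrite leeD2l.
  by rewrite -EFinD lee_fin; lra.
have massE i : (\int[L]_x (vl i x)%:E = (al i)%:E)%E.
  by apply/eqP; rewrite eq_le upper lower.
have vl_fin : {ae L, forall x, (\sum_(i <oo) (vl i x)%:E)%E \is a fin_num}.
  have : L.-integrable setT (fun x => \sum_(i <oo) (vl i x)%:E)%E.
    apply/integrableP; split.
      apply: ge0_emeasurable_sum => [i x _ _|i _]; first by rewrite lee_fin.
      exact/measurable_EFinP.
    have S0 x : (0 <= \sum_(i <oo) (vl i x)%:E)%E.
      by apply: nneseries_ge0 => i _ _; rewrite lee_fin.
    under eq_integral do rewrite gee0_abs//.
    rewrite integral_nneseries//; last 2 first.
    - by move=> i; exact/measurable_EFinP.
    - by move=> i x _; rewrite lee_fin.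
    by under eq_eseriesr do rewrite massE.
  by move=> /(integrable_ae measurableT); apply: filterS => x; exact.
(* [fine] gives [u] the value 0 on the null set where the series diverges, so [u] is real and
   nonnegative everywhere. *)
pose u x := fine (\sum_(i <oo) (vl i x)%:E)%E.
have mu : measurable_fun setT u.
  apply: measurableT_comp => //; apply: ge0_emeasurable_sum => [i x _ _|i _].
    by rewrite lee_fin.
  exact/measurable_EFinP.
have u0 x : 0 <= u x.
  by apply: fine_ge0; apply: nneseries_ge0 => i _ _; rewrite lee_fin.
exists vl, u; split => //.
- by split => //; apply: filterS vl_fin => x fx; rewrite /u fineK.
- apply: (@fatou_bound _ _ _ L (fun N x => h (\sum_(i < N) vl i x))) => //.
  + by move=> N; apply: measurableT_comp => //; have [] := nnfam_sum N nvl.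
  + exact: measurableT_comp.
  + apply: filterS vl_fin => x fx a au; have [V nV HV] := h_lsc au.
    have cu : \sum_(i < N) vl i x @[N --> \oo] --> u x.
      have : (\sum_(0 <= i < N) (vl i x)%:E)%E @[N --> \oo] -->
          (\sum_(i <oo) (vl i x)%:E)%E.
        by apply: is_cvg_nneseries => i _ _; rewrite lee_fin.
      rewrite -(fineK fx) -/(u x) => /fine_cvgP[_] /=.
      apply: cvg_trans; apply: near_eq_cvg; apply: nearW => N /=.
      by rewrite sumEFin /= big_mkord.
    have H : \forall N \near \oo, V (\sum_(i < N) vl i x) by exact: cu nV.
    by apply: filterS H => N /HV /ltW.
  + move=> e e0; apply: nearW => N; apply: le_trans (FN N) _.
    by rewrite lee_fin lerDl ltW.
- apply: lime_le.
    apply: is_cvg_nneseries => i _ _; apply: integral_ge0 => x _.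
    by have [_ c0'] := c0 i; rewrite lee_fin mulr_ge0.
  apply: nearW => N; rewrite big_mkord -ge0_integral_sum//; last 2 first.
  + move=> i; have [mc _] := c0 i.
    exact/measurable_EFinP/measurable_funM.
  + by move=> i x _; have [_ c0'] := c0 i; rewrite lee_fin mulr_ge0.
  under eq_integral do rewrite sumEFin.
  apply: (convex_fatou (G := fun x y => (\sum_(i < N) c i x * y i)%:E))
    hv nvl vvl _ _ _ _ (w_C N).
  + move=> x y y0; rewrite lee_fin; apply: sumr_ge0 => i _.
    by have [_ c0'] := c0 i; rewrite mulr_ge0.
  + move=> x y z y0 z0; rewrite -EFinD -EFinM -big_split mulr_suml lee_fin.
    by apply: ler_sum => i _ /=; rewrite -mulrDr mulrA.
  + move=> x z y zy; apply: EFin_lsc.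
    apply: cvg_big => [|i _]; first exact: add_continuous.
    by apply: cvgM => //; exact: cvg_cst.
  + move=> y ny; apply/measurable_EFinP; apply: measurable_sum => i.
    by apply: measurable_funM; [have [] := c0 i|have [] := ny i].
Qed.

End convex_limit.

(** * Measurability and continuity of the transport cost *)

Section euclidean_space.
Context (R : realType) (n : nat).
Implicit Types x y : 'rV[R]_n.

Lemma open_measurable_Rn (A : set 'rV[R]_n) : open A ->
  measurable (A : set (Rn R n)).
Proof. by move=> oA; exact: sub_sigma_algebra. Qed.

Lemma closed_measurable_Rn (A : set 'rV[R]_n) : closed A ->
  measurable (A : set (Rn R n)).
Proof.
move=> cA; have : measurable (~` A : set (Rn R n)).
  by apply: open_measurable_Rn; exact: closed_openC.
by move=> /measurableC; rewrite setCK.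
Qed.

Lemma compact_measurable_Rn (A : set 'rV[R]_n) : compact A ->
  measurable (A : set (Rn R n)).
Proof.
move=> cA; have hrV : hausdorff_space 'rV[R]_n by exact: norm_hausdorff.
exact: closed_measurable_Rn (compact_closed hrV cA).
Qed.

Lemma measurable_set1_Rn (x : 'rV[R]_n) : measurable ([set x] : set (Rn R n)).
Proof. by apply: compact_measurable_Rn; exact: compact_set1. Qed.

Lemma continuous_measurable_Rn (h : 'rV[R]_n -> R) : continuous h ->
  measurable_fun (setT : set (Rn R n)) (h : Rn R n -> R).
Proof.
move=> ch; apply: (measurability _ (RGenOpens.measurableE R)).
move=> _ [_ [a [b ->]]] <-; rewrite setTI; apply: open_measurable_Rn.
by apply: open_comp => //; exact: interval_open.
Qed.

Lemma measurable_coord (i : 'I_n) :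
  measurable_fun (setT : set (Rn R n)) (fun x : Rn R n => (x : 'rV[R]_n) ord0 i).
Proof. by apply: continuous_measurable_Rn; exact: coord_continuous. Qed.

Lemma enorm_ge0 x : 0 <= enorm x.
Proof. exact: sqrtr_ge0. Qed.

(** Argued by coordinates, because plans live on the product sigma-algebra and not, by definition,
    on the Borel sets of the product space. *)
Lemma measurable_enormB :
  measurable_fun setT (fun z : (Rn R n * Rn R n)%type =>
    enorm ((z.1 : 'rV[R]_n) - (z.2 : 'rV[R]_n))).
Proof.
rewrite /enorm; apply: measurableT_comp.
  by apply: continuous_measurable_fun; exact: sqrt_continuous.
apply: measurable_sum => i; apply: measurable_funX.
under eq_fun do rewrite !mxE.
apply: measurable_funB.
  exact: (measurableT_comp (measurable_coord i) measurable_fst).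
exact: (measurableT_comp (measurable_coord i) measurable_snd).
Qed.

Lemma continuous_enormB :
  continuous (fun z : 'rV[R]_n * 'rV[R]_n => enorm (z.1 - z.2)).
Proof.
move=> z; apply: (@continuous_comp _ _ _ _ (@Num.sqrt R)); last first.
  exact: sqrt_continuous.
apply: cvg_big => [|i _]; first exact: add_continuous.
have h : {for z, continuous (fun z' : 'rV[R]_n * 'rV[R]_n => (z'.1 - z'.2) ord0 i)}.
  apply: (@continuous_comp _ _ _ (fun z : 'rV[R]_n * 'rV[R]_n => z.1 - z.2)
    (fun x : 'rV[R]_n => x ord0 i)).
    by apply: cvgB; [exact: cvg_fst|exact: cvg_snd].
  exact: coord_continuous.
by rewrite expr2; under eq_fun do rewrite expr2; apply: cvgM.
Qed.

(** At 0 the bound [|s| ^ p <= |s|] for [|s| <= 1] suffices; elsewhere the power is an exponential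
    of a logarithm. The absolute value gives a function continuous on the whole line. *)
Lemma continuous_abs_powR (p : R) : 1 <= p -> continuous (fun t : R => `|t| `^ p).
Proof.
move=> p1 t; have [->|t0] := eqVneq t 0.
  apply/cvgrPdist_lt => e e0; near=> s.
  rewrite normr0 powR0; last by rewrite gt_eqF// (lt_le_trans ltr01).
  rewrite sub0r normrN ger0_norm ?powR_ge0//.
  have s1 : `|s| < 1 by near: s; apply: (nbhs0_lt (V := R)); exact: ltr01.
  apply: (@le_lt_trans _ _ `|s|); last by near: s; exact: (nbhs0_lt (V := R)).
  have [->|s0] := eqVneq s 0.
    by rewrite normr0 powR0// gt_eqF// (lt_le_trans ltr01).
  by apply: ge1r_powR => //; rewrite normr_gt0 s0 ltW.
have t1 : 0 < `|t| by rewrite normr_gt0.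
have : expR (p * ln `|s|) @[s --> t] --> expR (p * ln `|t|).
  apply: (@continuous_comp _ _ _ (fun s => p * ln `|s|) expR); last first.
    exact: continuous_expR.
  apply: cvgM; first exact: cvg_cst.
  apply: (@cvg_comp _ _ _ (fun s : R => `|s|) (@ln R) _ _ _ (@norm_continuous R R t)).
  exact: continuous_ln.
rewrite /continuous_at (_ : `|t| `^ p = expR (p * ln `|t|)); last first.
  by rewrite /powR gt_eqF.
apply: cvg_trans; apply: near_eq_cvg; near=> s.
rewrite /powR gt_eqF// normr_gt0; near: s.
by apply: (@cvgr_neq0 _ R _ _ _ id t) => //; exact: cvg_id.
Unshelve. all: by end_near. Qed.

Definition cost (p : R) x y : R := enorm (x - y) `^ p.

Lemma cost_ge0 p x y : 0 <= cost p x y. Proof. exact: powR_ge0. Qed.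

Lemma measurable_cost p : measurable_fun setT
  (fun z : (Rn R n * Rn R n)%type => cost p z.1 z.2).
Proof.
exact: (measurableT_comp (measurable_powR _) measurable_enormB).
Qed.

Lemma measurable_pairr (y : 'rV[R]_n) :
  measurable_fun setT (fun x : Rn R n => (x, y : Rn R n)).
Proof. by apply: measurable_fun_pair. Qed.

Lemma measurable_costr p y : measurable_fun (setT : set (Rn R n)) (cost p ^~ y).
Proof. exact: (measurableT_comp (measurable_cost p) (measurable_pairr y)). Qed.

(** Joint continuity becomes uniform in [x] by the near-covering form of compactness. This is what
    allows moving atoms to be replaced by their limits. *)
Lemma cost_near_uniform p (K : set 'rV[R]_n) y0 e : 1 <= p -> compact K -> 0 < e ->
  \forall y \near y0, forall x, K x -> `|cost p x y - cost p x y0| <= e.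
Proof.
move=> p1 cK e0.
have cc : continuous (fun z : 'rV[R]_n * 'rV[R]_n => cost p z.1 z.2).
  move=> z.
  rewrite (_ : (fun z => _) = (fun t : R => `|t| `^ p) \o (fun z => enorm (z.1 - z.2))).
    by apply: continuous_comp; [exact: continuous_enormB|exact: continuous_abs_powR].
  by apply/funext => z'; rewrite /= ger0_norm ?enorm_ge0.
move/compact_near_coveringP : cK => /(_ _ (nbhs y0)
  (fun y x => `|cost p x y - cost p x y0| <= e)); apply.
move=> x Kx.
have e2 : 0 < e / 2 by rewrite divr_gt0.
have : \forall z \near (x, y0), `|cost p x y0 - cost p z.1 z.2| < e / 2.
  by have /cvgrPdist_lt/(_ _ e2) := cc (x, y0).
move=> [[U V] [/= xU y0V] UV].
exists (U, V) => // -[x' y] [/= Ux' Vy].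
have h1 : `|cost p x y0 - cost p x' y| < e / 2 by exact: (UV (x', y)).
have h2 : `|cost p x y0 - cost p x' y0| < e / 2.
  by apply: (UV (x', y0)); split => //; exact: nbhs_singleton.
move: (cost p x y0) (cost p x' y) (cost p x' y0) h1 h2 => A B C h1 h2.
rewrite (_ : B - C = (A - C) - (A - B)); last by ring.
by apply: le_trans (ler_normB _ _) _; lra.
Qed.

Lemma compact_bounded_Rn (K : set 'rV[R]_n) : compact K ->
  exists M, forall x, K x -> forall i, `|x ord0 i| <= M.
Proof.
move=> /compact_bounded [M [_ HM]]; exists (M + 1) => x Kx i.
apply: le_trans (HM _ _ x Kx); last by rewrite ltrDl.
rewrite [leRHS]mx_normrE; apply: (le_bigmax _ (fun ij => `|x ij.1 ij.2|) (ord0, i)).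
Qed.

Lemma compact_lebesgue_lty (lam : {measure set (Rn R n) -> \bar R})
    (K : set 'rV[R]_n) : is_lebesgue lam -> compact K -> (lam K < +oo)%E.
Proof.
move=> Hl cK; have [M HM] := compact_bounded_Rn cK.
have [[x Kx]|K0] := pselect (K !=set0); last first.
  by move/set0P/negP/negPn/eqP : K0 => ->; rewrite measure0.
(* The absolute value orders the two corners of the box whatever the sign of [M]. *)
pose b : 'rV[R]_n := \row_i `|M|.
have mb : measurable (box (- b) b).
  rewrite (_ : box _ _ = \bigcap_(i in [set: 'I_n])
      [set x : Rn R n | (- b) ord0 i <= (x : 'rV[R]_n) ord0 i <= b ord0 i]).
    apply: fin_bigcap_measurable => // i _.
    rewrite (_ : [set x | _] = (fun x : Rn R n => (x : 'rV[R]_n) ord0 i) @^-1`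
        `[(- b) ord0 i, b ord0 i]%classic); last first.
      by apply/funext => y /=; rewrite in_itv.
    rewrite -[X in measurable X]setTI.
    by apply: measurable_coord => //; exact: measurable_itv.
  by apply/seteqP; split=> [y yb i _|y yb i]; exact: yb.
apply: (@le_lt_trans _ _ (lam (box (- b) b))).
  apply: le_measure; rewrite ?inE//; first exact: compact_measurable_Rn.
  move=> y Ky i; rewrite !mxE -ler_norml.
  by apply: le_trans (HM _ Ky i) (ler_norm _).
rewrite Hl ?ltry// => i; rewrite !mxE.
by rewrite (@le_trans _ _ 0)// oppr_le0.
Qed.

End euclidean_space.

(** * The convex function [f] on the real line *)

Section convex_density.
Context (R : realType) (f : \bar R -> \bar R).
Hypothesis f0 : forall x : \bar R, (0 <= x)%E -> (0 <= f x)%E.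
Hypothesis f_lsc : lsc_on [set x : \bar R | (0 <= x)%E] f.
Hypothesis f_convex : forall (x y : \bar R) (t : R), (0 <= x)%E -> (0 <= y)%E ->
  0 <= t <= 1 -> (f (t%:E * x + (1 - t)%:E * y) <= t%:E * f x + (1 - t)%:E * f y)%E.
Hypothesis f00 : f 0%E = 0%E.
Hypothesis f_superlinear : (f t%:E * (t^-1)%:E)%E @[t --> +oo] --> +oo%E.

(** Extending [f] by its value at 0 to the negative reals gives a function that is lower
    semicontinuous and nondecreasing on the whole line, hence measurable. *)
Definition posext (t : R) : \bar R := f (Num.max t 0)%:E.

Lemma posextE t : 0 <= t -> posext t = f t%:E.
Proof. by move=> t0; rewrite /posext max_l. Qed.

Let max0 (t : R) : (0 <= (Num.max t 0)%:E)%E.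
Proof. by rewrite lee_fin le_max lexx orbT. Qed.

Lemma posext_ge0 t : (0 <= posext t)%E.
Proof. exact: f0. Qed.

(** Convexity between 0 and [t] gives [f s <= (s / t) * f t], since [f] vanishes at 0, and
    [f t >= 0] absorbs the factor. *)
Lemma posext_nondecreasing s t : s <= t -> (posext s <= posext t)%E.
Proof.
move=> st; have [s0|s0] := leP s 0.
  by rewrite {1}/posext max_r// f00 posext_ge0.
have t0 : 0 < t by exact: lt_le_trans st.
rewrite !posextE; [|exact: ltW|exact: ltW].
have st1 : 0 <= s / t <= 1.
  by apply/andP; split; [apply: divr_ge0; exact: ltW|rewrite ler_pdivrMr// mul1r].
have t0' : (0 <= t%:E)%E by rewrite lee_fin ltW.
have H := f_convex t0' (lexx 0%E) st1.
rewrite mule0 adde0 f00 mule0 adde0 -EFinM divfK in H; last by rewrite gt_eqF.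
apply: le_trans H _; rewrite -[leRHS]mul1e; apply: lee_wpmul2r.
  by apply: f0; rewrite lee_fin ltW.
by case/andP: st1 => _ ?; rewrite lee_fin.
Qed.

Lemma posext_lsc : lower_semicontinuous posext.
Proof.
move=> t a at_; have [V nV HV] := f_lsc (max0 t) at_.
have ct : (Num.max s 0)%:E @[s --> t] --> (Num.max t 0)%:E.
  apply: cvg_EFin; first exact: nearW.
  have cmax : {for t, continuous (fun s : R => Num.max s 0)}.
    by apply: continuous_max; [exact: cvg_id|exact: cvg_cst].
  exact: cmax.
exists [set s | V (Num.max s 0)%:E]; first exact: ct.
by move=> s /= Vs; apply: HV => //; exact: max0.
Qed.

Lemma posext_mid s t : 0 <= s -> 0 <= t ->
  (posext ((s + t) / 2)%R <= (posext s + posext t) * (2^-1)%:E)%E.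
Proof.
move=> s0 t0; rewrite !posextE ?divr_ge0 ?addr_ge0//.
have h0 : 0 <= 2^-1 :> R by lra.
have h1 : 2^-1 <= 1 :> R by lra.
have h : 0 <= (2^-1 : R) <= 1 by rewrite h0 h1.
have s0' : (0 <= s%:E)%E by rewrite lee_fin.
have t0' : (0 <= t%:E)%E by rewrite lee_fin.
have H := f_convex s0' t0' h.
have e : (1 - 2^-1 = 2^-1 :> R) by field.
rewrite e -!EFinM -EFinD -mulrDr mulrC in H.
apply: le_trans H _; rewrite muleC [X in (_ + X)%E]muleC ge0_muleDl//;
  by apply: f0; rewrite lee_fin.
Qed.

Lemma posext_superlinear M : 0 < M ->
  exists2 t0, 0 <= t0 & forall t, t0 <= t -> ((M * t)%:E <= posext t)%E.
Proof.
move=> M0; have /cvgeyPge/(_ M) := f_superlinear.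
(* [A + 1] provides the strict inequality [A < t], and 1 keeps [t] positive for the division. *)
move=> [A [_ HA]]; exists (Num.max (A + 1) 1) => [|t].
  by rewrite le_max ler01 orbT.
rewrite ge_max => /andP[At t1].
have t0 : 0 < t by exact: lt_le_trans t1.
have := HA t; rewrite (lt_le_trans _ At) ?ltrDl// => /(_ isT) H.
rewrite posextE; last exact: ltW.
rewrite EFinM.
by rewrite -lee_pdivlMr.
Qed.

End convex_density.

(** * The subadditive function [g] *)

Section subadditive_mass.
Context (R : realType) (g : R -> \bar R).
Hypothesis g_ge0 : forall t : R, 0 <= t <= 1 -> (0 <= g t)%E.
Hypothesis g_sub : forall x y : R, 0 <= x -> 0 <= y -> x + y <= 1 ->
  (g (x + y)%R <= g x + g y)%E.
Hypothesis g_lsc : lsc_on [set t : R | 0 <= t <= 1] g.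
Hypothesis g0 : g 0 = 0%E.
Hypothesis g_infinite_slope : (g t * (t^-1)%:E)%E @[t --> 0^'+] --> +oo%E.

Lemma lsc_cvg (a : nat -> R) (l : R) (b : nat -> R) (m : R) :
  (forall k, 0 <= a k <= 1) -> (forall k, (g (a k) <= (b k)%:E)%E) ->
  a k @[k --> \oo] --> l -> b k @[k --> \oo] --> m -> (g l <= m%:E)%E.
Proof.
move=> a01 gb al bm.
have l01 : 0 <= l <= 1.
  have cl : cvgn a by apply/cvg_ex; exists l.
  rewrite -(cvg_lim (@Rhausdorff R) al); apply/andP; split.
    by apply: limr_ge => //; apply: nearW => k; case/andP: (a01 k).
  by apply: limr_le => //; apply: nearW => k; case/andP: (a01 k).
rewrite leNgt; apply/negP => mg.
have [r mr rg] : exists2 r : R, m < r & (r%:E < g l)%E.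
  case: (g l) mg => [r| |]//.
    rewrite lte_fin => mr; exists ((m + r) / 2); rewrite ?lte_fin ?midf_lt//.
  by move=> _; exists (m + 1); rewrite ?ltrDl// ltry.
have [V nV HV] := g_lsc l01 rg.
have H1 : \forall k \near \oo, V (a k) by exact: al nV.
have H2 : \forall k \near \oo, b k < r by exact: (cvgr_lt _ bm).
have [k [/HV Va br]] := filter_ex (filterI H1 H2).
have := lt_le_trans (Va (a01 k)) (gb k).
by rewrite lte_fin => /(lt_trans br); rewrite ltxx.
Qed.

Lemma subadditive_sum (a : nat -> R) N : (forall i, 0 <= a i) ->
  \sum_(i < N) a i <= 1 -> (g (\sum_(i < N) a i)%R <= \sum_(i < N) g (a i))%E.
Proof.
move=> a0; elim: N => [|N IH]; first by rewrite !big_ord0 g0.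
rewrite !big_ord_recr /= => s1.
have s0 : 0 <= \sum_(i < N) a i by apply: sumr_ge0.
apply: le_trans (g_sub s0 (a0 N) s1) _.
by rewrite leeD2r// IH// (le_trans _ s1)// lerDl.
Qed.

(** Finite subadditivity bounds [g] at the partial sums by the full series, and lower semicontinuity
    at [s] removes the truncation. *)
Lemma subadditive_series (a : nat -> R) (s : R) : (forall i, 0 <= a i) ->
  (\sum_(i <oo) (a i)%:E = s%:E)%E -> s <= 1 ->
  (g s <= \sum_(i <oo) g (a i))%E.
Proof.
move=> a0 as_ s1.
have aN N : \sum_(i < N) a i <= s.
  rewrite -lee_fin -as_ -sumEFin -(big_mkord xpredT (EFin \o a)).
  by apply: nneseries_lim_ge => i _; rewrite lee_fin.
have a1 i : 0 <= a i <= 1.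
  rewrite a0 /= (le_trans _ s1)// (le_trans _ (aN i.+1))// big_ord_recr /=.
  by rewrite lerDr sumr_ge0.
have ga i : (0 <= g (a i))%E by exact: g_ge0.
have [|] := boolP ((\sum_(i <oo) g (a i))%E \is a fin_num); last first.
  rewrite ge0_fin_numE ?nneseries_ge0// -leNgt leye_eq => /eqP ->.
  exact: leey.
move=> fg; rewrite -(fineK fg).
have cs : \sum_(i < N) a i @[N --> \oo] --> s.
  have : (\sum_(0 <= i < N) (a i)%:E)%E @[N --> \oo] --> (\sum_(i <oo) (a i)%:E)%E.
    by apply: is_cvg_nneseries => i _ _; rewrite lee_fin.
  rewrite as_ => /fine_cvgP[_] /=.
  apply: cvg_trans; apply: near_eq_cvg; apply: nearW => N /=.
  by rewrite sumEFin /= big_mkord.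
apply: (lsc_cvg (b := fun=> fine (\sum_(i <oo) g (a i))%E)) _ _ cs (cvg_cst _).
- by move=> N; rewrite sumr_ge0//= (le_trans (aN N)).
- move=> N; rewrite fineK//.
  apply: le_trans (subadditive_sum a0 (le_trans (aN N) s1)) _.
  by rewrite -(big_mkord xpredT (fun i => g (a i))); exact: nneseries_lim_ge.
Qed.

Lemma steep_at0 M : exists2 dl, 0 < dl &
  forall t, 0 <= t -> t <= dl -> t <= 1 -> ((M * t)%:E <= g t)%E.
Proof.
have /cvgeyPge/(_ M) := g_infinite_slope.
(* Half the radius, because the neighbourhood is an open ball and the claim includes [t = dl]. *)
move=> [dl /= dl0 Hdl]; exists (dl / 2); first by rewrite divr_gt0.
move=> t; rewrite le_eqVlt => /predU1P[<- _ _|t0 tdl t1].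
  by rewrite mulr0 g0.
have := Hdl t; rewrite /ball_ /= sub0r normrN gtr0_norm// => /(_ _ t0) H.
rewrite EFinM -lee_pdivlMr//; apply: H.
by apply: le_lt_trans tdl _; rewrite ltr_pdivrMr// ltr_pMr// ltr1n.
Qed.

End subadditive_mass.

(** * Slicing a transport plan along the atoms *)

Definition image_measure d1 d2 (T1 : measurableType d1) (T2 : measurableType d2)
    (R : realType) (m : {measure set T1 -> \bar R}) (h : T1 -> T2)
    (mh : measurable_fun setT h) : {measure set T2 -> \bar R} :=
  measure_function_pushforward__canonical__measure_function_Measure m mh.

Lemma ge0_integral_image_measure d1 d2 (T1 : measurableType d1)
    (T2 : measurableType d2) (R : realType) (m : {measure set T1 -> \bar R})
    (h : T1 -> T2) (mh : measurable_fun setT h) (k : T2 -> \bar R) :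
  measurable_fun setT k -> (forall y, (0 <= k y)%E) ->
  (\int[image_measure m mh]_y k y = \int[m]_x k (h x))%E.
Proof.
by move=> mk k0; rewrite /image_measure ge0_integral_pushforward// preimage_setT.
Qed.

Lemma measure_sum_le d (T : measurableType d) (R : realType)
    (mu : {measure set T -> \bar R}) (B : set T) (D : nat -> set T) N :
  measurable B -> (forall i, measurable (D i)) -> trivIset setT D ->
  (\sum_(i < N) mu (B `&` D i) <= mu B)%E.
Proof.
move=> mB mD tD.
have mBD i : measurable (B `&` D i) by exact: measurableI.
have mU : measurable (\big[setU/set0]_(i < N) (B `&` D i)).
  by apply: bigsetU_measurable => i _.
rewrite -(measure_semi_additive_ord_I mu (F := fun i => B `&` D i))//.
- apply: le_measure; rewrite ?inE//.
  by rewrite -(bigcup_mkord N (fun i => B `&` D i)) => x [i _ []].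
- by apply: (@sub_trivIset _ _ _ setT) => //; apply: trivIset_setIl.
Qed.

(** Radon-Nikodym for the first marginal of the plan restricted to second coordinates in [S]; this
    marginal is dominated by the one of the whole plan, hence by [L]. *)
Lemma slice_density d1 d2 (T1 : measurableType d1) (T2 : measurableType d2)
    (R : realType) (L : {measure set T1 -> \bar R})
    (gam : {measure set (T1 * T2)%type -> \bar R}) (S : set T2) :
  (L setT < +oo)%E -> (gam setT < +oo)%E -> measurable S ->
  (forall A, measurable A -> L A = 0%E -> gam (fst @^-1` A) = 0%E) ->
  exists w : T1 -> R, [/\ measurable_fun setT w, forall x, 0 <= w x,
    forall A, measurable A ->
      gam (fst @^-1` A `&` snd @^-1` S) = (\int[L]_(x in A) (w x)%:E)%E &
    forall h : T1 -> \bar R, measurable_fun setT h -> (forall x, (0 <= h x)%E) ->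
      (\int[L]_x (h x * (w x)%:E) = \int[gam]_(z in snd @^-1` S) h z.1)%E].
Proof.
move=> Loo gamoo mS dom.
have mfst A : measurable A -> measurable (fst @^-1` A : set (T1 * T2)).
  by move=> mA; rewrite -[X in measurable X]setTI; exact: measurable_fst.
have mD : measurable (snd @^-1` S : set (T1 * T2)).
  by rewrite -[X in measurable X]setTI; exact: measurable_snd.
pose nu0 := image_measure (mrestr gam mD) (@measurable_fst _ _ T1 T2).
have nu0oo : (nu0 setT < +oo)%E.
  apply: le_lt_trans gamoo; apply: le_measure; rewrite ?inE//.
  by rewrite preimage_setT setTI.
have nu0E A : nu0 A = gam (fst @^-1` A `&` snd @^-1` S) by [].
(* Restricting to the whole space alters no value; it only bundles the finiteness that Radon-Nikodym
   asks for. *)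
pose nu1 : {finite_measure set T1 -> \bar R} := mfrestr measurableT nu0oo.
pose L1 : {finite_measure set T1 -> \bar R} := mfrestr measurableT Loo.
have nu1E A : nu1 A = nu0 A by rewrite -[in RHS](setIT A).
have L1E A : L1 A = L A by rewrite -[in RHS](setIT A).
have domL : nu1 `<< L1.
  apply/null_content_dominatesP => A mA L1A.
  have LA : L A = 0%E by rewrite -L1E.
  suff : nu1 A = 0%E by [].
  rewrite nu1E nu0E; apply/eqP; rewrite -measure_le0 -(dom A mA LA).
  apply: le_measure; rewrite ?inE//; first by apply: measurableI => //; exact: mfst.
  exact: mfst.
have [w [w0 wfin wint wE]] := radon_nikodym_sigma_finite domL.
have mw : measurable_fun setT (fine \o w).
  by apply: measurableT_comp => //; exact: measurable_int wint.
have wE' A : measurable A -> nu0 A = (\int[L]_(x in A) (fine (w x))%:E)%E.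
  move=> mA; rewrite -nu1E wE//.
  transitivity (\int[L]_(x in A) w x)%E.
    by apply: eq_measure_integral => B mB _; exact: L1E.
  by apply: eq_integral => x _; rewrite fineK.
exists (fine \o w); split => //.
- by move=> x; rewrite fine_ge0.
- move=> h mh h0.
  rewrite -(@integral_density _ _ _ L nu0 (fine \o w))//.
    rewrite ge0_integral_image_measure// ge0_integral_mrestr//.
    by apply: measurableT_comp => //; exact: measurable_fst.
  by move=> x; rewrite fine_ge0.
Qed.

(** The bounds concern finite sums, the only ones that index-wise convergence controls directly.
    Distinctness of the points is not recorded, as distinct points may have a common limit, and zero
    masses fill up a finite list of atoms. [cfg_decay] is the trace of the greedy order. *)
Record configuration (R : realType) (n : nat) (Om : set 'rV[R]_n)
    (L : {measure set (Rn R n) -> \bar R}) (p : R) (f : \bar R -> \bar R)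
    (g : R -> \bar R) (x : nat -> 'rV[R]_n) (w : nat -> Rn R n -> R)
    (a : nat -> R) (Tc Fc Gc : R) : Prop := Configuration {
  cfg_Om : forall i, Om (x i);
  cfg_nn : nnfam w;
  cfg_mass : forall i, (\int[L]_y (w i y)%:E = (a i)%:E)%E;
  cfg_ge0 : forall i, 0 <= a i;
  cfg_decay : forall i, a i * i.+1%:R <= 2;
  cfg_sum1 : (\sum_(i <oo) (a i)%:E = 1)%E;
  cfg_T : forall N, (\int[L]_y (\sum_(i < N) cost p y (x i) * w i y)%:E <= Tc%:E)%E;
  cfg_F : forall N, (\int[L]_y posext f (\sum_(i < N) w i y) <= Fc%:E)%E;
  cfg_G : forall N, (\sum_(i < N) g (a i) <= Gc%:E)%E }.

Section disintegration.
Context (R : realType) (n : nat).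
Local Notation T := (Rn R n).
Variables (Om : set 'rV[R]_n) (mOm : measurable (Om : set T)).
Variables (lam : {measure set T -> \bar R}).
Hypothesis lamOm : (lam Om < +oo)%E.
Variables (p : R) (f : \bar R -> \bar R) (g : R -> \bar R).
Hypothesis f0 : forall x : \bar R, (0 <= x)%E -> (0 <= f x)%E.
Hypothesis f_lsc : lsc_on [set x : \bar R | (0 <= x)%E] f.
Hypothesis f_nd : forall s t, s <= t -> (posext f s <= posext f t)%E.
Hypothesis g0 : g 0 = 0%E.
Variables (mu nu : probability T R).
Hypothesis nuOm : in_P Om nu.
Hypothesis nu_atomic : nu (~` atoms nu) = 0%E.

Let L : {measure set T -> \bar R} := mrestr lam mOm.

Let m (y : T) : R := fine (nu [set y]).

Let mset1 (y : T) : measurable [set y]. Proof. exact: measurable_set1_Rn. Qed.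

Let mE y : nu [set y] = (m y)%:E.
Proof. by rewrite /m fineK// fin_num_measure. Qed.

Let m0 y : 0 <= m y. Proof. by rewrite fine_ge0. Qed.

Let atomE y : atoms nu y = (0 < m y). Proof. by rewrite /atoms /= mE lte_fin. Qed.

Lemma atom_Om y : atoms nu y -> Om y.
Proof.
rewrite /atoms /= => y0; apply: contrapT => nOm; move: y0.
suff -> : nu [set y] = 0%E by rewrite ltxx.
apply/eqP; rewrite -measure_le0 -nuOm; apply: le_measure; rewrite ?inE//.
  exact: measurableC.
by move=> _ ->.
Qed.

Let sum_m (s : seq T) : uniq s -> \sum_(y <- s) m y <= 1.
Proof.
move=> us.
have [ms H] : measurable ([set` s] : set T) /\ nu [set` s] = (\sum_(y <- s) m y)%:E.
  elim: s us => [_|y s IH /= /andP[ys us]].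
    rewrite big_nil (_ : [set` [::]] = set0); last by apply/seteqP; split.
    by rewrite measure0; split.
  have [ms nus] := IH us.
  have -> : [set` y :: s] = [set y] `|` [set` s].
    apply/seteqP; split=> z /=; rewrite inE.
      by move=> /predU1P[->|zs]; [left|right].
    by move=> [->|zs]; [rewrite eqxx|rewrite zs orbT].
  split; first by apply: measurableU => //; exact: mset1.
  rewrite big_cons EFinD -nus -mE measureU//.
  by apply/seteqP; split=> [z [/= -> yin]|//]; rewrite yin in ys.
by rewrite -lee_fin -H; exact: probability_le1.
Qed.

Let e_spec := greedy_enumeration sum_m.

(** [w i] is the density of the first marginal of the slice of [gam] over the [i]-th atom. The
    slices are disjoint, so their costs and densities add up to no more than those of the whole
    plan. *)
Lemma disintegration (gam : probability (T * T)%type R) (u : T -> R) :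
  coupling mu nu gam -> is_density Om lam mu u ->
  forall (x0 : T) (Tc Fc Gc : R), Om x0 ->
  (\int[gam]_(z in setT) ((enorm (z.1 - z.2 : 'rV[R]_n)) `^ p)%:E <= Tc%:E)%E ->
  (\int[lam]_(x in (Om : set T)) f (u x)%:E <= Fc%:E)%E ->
  (\esum_(x in atoms nu) g (fine (nu [set x])) <= Gc%:E)%E ->
  exists x, exists w, exists a, configuration Om L p f g x w a Tc Fc Gc.
Proof.
move=> [gam1 gam2] [mu_ u0 uint uE] x0 Tc Fc Gc Omx0 HT HF HG.
have [e [einj ecov edec]] := e_spec.
(* An index without an atom gets a dummy point of [Om], an empty slice and mass 0. *)
pose x i : T := odflt x0 (e i).
pose D i : set T := if e i is Some y then [set y] else set0.
pose a i : R := if e i is Some y then m y else 0.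
have mD i : measurable (D i) by rewrite /D; case: (e i).
have nuD i : nu (D i) = (a i)%:E.
  by rewrite /D /a; case: (e i) => [y|]; rewrite ?measure0.
have tD : trivIset setT D.
  move=> i j _ _ [z []]; rewrite /D.
  case Ei : (e i) => [y|//]; case Ej : (e j) => [y'|//] /= -> yy.
  by apply: einj Ei _; rewrite Ej yy.
have DOm i z : D i z -> z = x i.
  by rewrite /D /x; case: (e i) => [y|//] /= ->.
have Loo : (L setT < +oo)%E by rewrite /L /= /mrestr setTI.
(* The first marginal is [mu], which has a density on [Om], so the plan ignores strips over [L]-null
   sets. *)
have dom A : measurable A -> L A = 0%E -> gam (fst @^-1` A) = 0%E.
  move=> mA LA; rewrite gam1// uE//.
  have mAO : measurable (A `&` Om) by exact: measurableI.
  rewrite (eq_integral (fun x => `|(u x)%:E|%E)).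
    apply: integral_abs_eq0 => //; apply/measurable_EFinP.
    by apply: measurable_funS mu_ => //; exact: subIsetr.
  by move=> z /set_mem[_ Oz]; rewrite gee0_abs// lee_fin u0.
have /choice[w Hw] : forall i, exists w : T -> R, [/\ measurable_fun setT w,
    forall x, 0 <= w x,
    forall A, measurable A ->
      gam (fst @^-1` A `&` snd @^-1` (D i)) = (\int[L]_(x in A) (w x)%:E)%E &
    forall h : T -> \bar R, measurable_fun setT h -> (forall x, (0 <= h x)%E) ->
      (\int[L]_x (h x * (w x)%:E) = \int[gam]_(z in snd @^-1` (D i)) h z.1)%E].
  move=> i; apply: slice_density => //.
  by rewrite ltey_eq fin_num_measure.
have nw : nnfam w by move=> i; have [] := Hw i.
have w0 i y : 0 <= w i y by have [] := nw i.
have mw i : measurable_fun setT (w i) by have [] := nw i.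
have msnd i : measurable (snd @^-1` (D i) : set (T * T)).
  by rewrite -[X in measurable X]setTI; exact: measurable_snd.
have tsnd : trivIset setT (fun i => snd @^-1` (D i) : set (T * T)).
  by move=> i j _ _ [z [zi zj]]; apply: tD => //; exists z.2.
have mass i : (\int[L]_y (w i y)%:E = (a i)%:E)%E.
  have [_ _ H _] := Hw i; rewrite -H// preimage_setT setTI gam2//.
(* Cutting [u] off outside [Om] makes it measurable and nonnegative on the whole space. *)
pose u' := u \_ (Om : set T).
have mu' : measurable_fun setT u'.
  by apply/(measurable_restrictT _ mOm).
have u'0 y : 0 <= u' y.
  by rewrite /u' patchE; case: ifPn => // /set_mem /u0.
have Lu A : measurable A -> (\int[L]_(y in A) (u' y)%:E = mu A)%E.
  move=> mA; rewrite integral_mkcond ge0_integral_mrestr; last 2 first.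
  - by apply/(measurable_restrictT _ mA); exact/measurable_funTS/measurable_EFinP.
  - by move=> y; rewrite patchE; case: ifP => //; rewrite lee_fin.
  rewrite -integral_mkcondr uE// setIC.
  by apply: eq_integral => y /set_mem[_ Oy]; rewrite /u' patchE mem_set.
(* Over each [A] the plan masses of the disjoint slices add up to at most [mu A]; this compares the
   densities. *)
have Sle N : {ae L, forall y, \sum_(i < N) w i y <= u' y}.
  apply: ae_le_of_integral_le => //.
  - by apply: measurable_sum.
  - by move=> y; apply: sumr_ge0.
  - by rewrite Lu// ltey_eq fin_num_measure.
  move=> A mA; rewrite Lu//.
  under eq_integral do rewrite -sumEFin.
  rewrite ge0_integral_sum//; last 2 first.
  - by move=> i; apply/measurable_funTS/measurable_EFinP.
  - by move=> i y _; rewrite lee_fin.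
  rewrite -gam1//.
  have mfA : measurable (fst @^-1` A : set (T * T)).
    by rewrite -[X in measurable X]setTI; exact: measurable_fst.
  apply: le_trans (measure_sum_le gam N mfA msnd tsnd).
  by apply: lee_sum => i _; have [_ _ H _] := Hw i; rewrite -H.
exists x, w, a; split => //.
- move=> i; rewrite /x; case E : (e i) => [y|//] /=.
  by apply: atom_Om; rewrite atomE; have [] := edec i y E.
- by move=> i; rewrite /a; case: (e i).
- move=> i; rewrite /a; case E : (e i) => [y|]; last by rewrite mul0r.
  by have [] := edec i y E.
- under eq_eseriesr do rewrite -nuD.
  (* As a countable union of points the atoms are measurable, and since [nu] is concentrated on them
     their masses have sum 1. *)
  have atU : atoms nu = \bigcup_i D i.
    apply/seteqP; split=> y.
      rewrite atomE => /ecov[i Ei]; exists i => //; by rewrite /D Ei.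
    move=> [i _]; rewrite /D; case E : (e i) => [z|//] /= ->.
    by rewrite atomE; have [] := edec i z E.
  have mat : measurable (atoms nu).
    by rewrite atU; exact: bigcup_measurable.
  have nu1 : nu (atoms nu) = 1%E.
    have := probability_setC nu mat; rewrite nu_atomic => /esym/eqP.
    by rewrite sube_eq ?fin_num_measure// add0e => /eqP.
  have mU : measurable (\bigcup_i D i) by rewrite -atU.
  by rewrite -nu1 atU measure_semi_bigcup.
- move=> N.
  under eq_integral do rewrite -sumEFin.
  have mc i : measurable_fun (setT : set T) (fun y : T => cost p y (x i)).
    exact: measurable_costr.
  rewrite ge0_integral_sum//; last 2 first.
  - by move=> i; apply/measurable_EFinP/measurable_funM.
  - by move=> i y _; rewrite lee_fin mulr_ge0// cost_ge0.
  have c20 (z : (T * T)%type) : 0 <= cost p z.1 z.2 := cost_ge0 p z.1 z.2.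
  have mc2 := @measurable_cost R n p.
  (* The cost times the plan is itself a measure, so disjointness of the slices bounds the sum of
     their costs by the total cost. *)
  pose gc : {measure set (T * T)%type -> \bar R} := density_measure gam mc2 c20.
  apply: le_trans HT.
  apply: le_trans (measure_sum_le gc N measurableT msnd tsnd).
  apply: lee_sum => i _; rewrite /gc /= /density_measure setTI.
  have [_ _ _ H] := Hw i.
  have Hc : (\int[L]_y (cost p y (x i) * w i y)%:E =
      \int[gam]_(z in snd @^-1` (D i)) (cost p z.1 (x i))%:E)%E.
    rewrite -(H (fun y => (cost p y (x i))%:E)).
    - by apply: eq_integral => y _; rewrite EFinM.
    - exact/measurable_EFinP.
    - by move=> y; rewrite lee_fin cost_ge0.
  rewrite Hc.
  rewrite le_eqVlt; apply/orP; left; apply/eqP.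
  by apply: eq_integral => z /set_mem /= /DOm ->.
- move=> N.
  have mpf : measurable_fun setT (posext f).
    by apply: lower_semicontinuous_measurable; exact: posext_lsc.
  have pf0 t : (0 <= posext f t)%E by exact: posext_ge0.
  apply: (@le_trans _ _ (\int[L]_y posext f (u' y))%E).
    apply: ae_ge0_le_integral => //.
    - by apply: measurableT_comp => //; exact: measurable_sum.
    - exact: measurableT_comp.
    - by apply: filterS (Sle N) => y Hy _; exact: f_nd.
  rewrite ge0_integral_mrestr//; last exact: measurableT_comp.
  apply: le_trans HF; rewrite le_eqVlt; apply/orP; left; apply/eqP.
  apply: eq_integral => y yO; rewrite /u' patchE yO posextE//.
  by apply: u0; exact: set_mem.
- move=> N; apply: le_trans HG; apply: esum_ge.
  (* The atoms among the first [N] indices form one finite set in the supremum that defines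
     [esum]. *)
  pose s := pmap e (iota 0 N).
  have us : uniq s.
    rewrite /s; elim: (iota 0 N) (iota_uniq 0 N) => // i r IH /= /andP[ir ur].
    rewrite /oapp; case Ei : (e i) => [y|]; last exact: IH.
    rewrite /= IH// andbT mem_pmap; apply/negP => /mapP[j jr /esym Ej].
    by move: ir; rewrite (einj _ _ _ Ei Ej) jr.
  exists [set` s].
    split; first exact: finite_seq.
    move=> y /=; rewrite mem_pmap => /mapP[i _ /esym Ei].
    by rewrite atomE; have [] := edec i y Ei.
  rewrite -fsbig_seq// big_pmap -(big_mkord xpredT (fun i => g (a i))) /index_iota subn0.
  apply: lee_sum => i _; rewrite /a; case: (e i) => //=.
  by rewrite g0.
Qed.

End disintegration.

(** * Rebuilding a pair of measures from points and densities *)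

Section reconstruction.
Context (R : realType) (n : nat).
Local Notation T := (Rn R n).
Variables (Om : set 'rV[R]_n) (mOm : measurable (Om : set T)).
Variables (lam : {measure set T -> \bar R}).
Variables (p : R) (f : \bar R -> \bar R) (g : R -> \bar R).
Hypothesis f0 : forall x : \bar R, (0 <= x)%E -> (0 <= f x)%E.
Hypothesis f_lsc : lsc_on [set x : \bar R | (0 <= x)%E] f.
Hypothesis g_ge0 : forall t : R, 0 <= t <= 1 -> (0 <= g t)%E.
Hypothesis g_sub : forall x y : R, 0 <= x -> 0 <= y -> x + y <= 1 ->
  (g (x + y)%R <= g x + g y)%E.
Hypothesis g_lsc : lsc_on [set t : R | 0 <= t <= 1] g.
Hypothesis g0 : g 0 = 0%E.

Let L : {measure set T -> \bar R} := mrestr lam mOm.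

Variables (x : nat -> 'rV[R]_n) (v : nat -> T -> R) (u : T -> R) (al : nat -> R).
Hypothesis xOm : forall i, Om (x i).
Hypothesis nv : nnfam v.
Hypothesis v_mass : forall i, (\int[L]_y (v i y)%:E = (al i)%:E)%E.
Hypothesis al0 : forall i, 0 <= al i.
Hypothesis al_sum1 : (\sum_(i <oo) (al i)%:E = 1)%E.
Hypothesis mu_ : measurable_fun setT u.
Hypothesis u0 : forall y, 0 <= u y.
Hypothesis uE : {ae L, forall y, (\sum_(i <oo) (v i y)%:E = (u y)%:E)%E}.

Let mv i : measurable_fun setT (v i). Proof. by have [] := nv i. Qed.
Let v0 i y : 0 <= v i y. Proof. by have [] := nv i. Qed.

(** The product of the measure [v i] times [L] with the Dirac mass at [x i], realised as an image
    under [y] to [(y, x i)]. Their sum is the plan, and both measures are its marginals. *)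
Let gami (i : nat) : {measure set (T * T)%type -> \bar R} :=
  image_measure (density_measure L (mv i) (v0 i)) (measurable_pairr (x i)).

Let gam0 : {measure set (T * T)%type -> \bar R} := mseries gami 0.

Let gam0E A : gam0 A = (\sum_(i <oo) \int[L]_(y in [set y | A (y, x i : T)]) (v i y)%:E)%E.
Proof. by []. Qed.

Let gam0T : gam0 setT = 1%E.
Proof. by rewrite gam0E -al_sum1; apply: eq_eseriesr => i _; rewrite -v_mass. Qed.

Let fst1 A : gam0 (fst @^-1` A) = (\sum_(i <oo) \int[L]_(y in A) (v i y)%:E)%E.
Proof. by []. Qed.

Let snd1 (B : set T) :
  gam0 (snd @^-1` B) = (\sum_(i <oo) if `[< B (x i) >] then (al i)%:E else 0)%E.
Proof.
rewrite gam0E; apply: eq_eseriesr => i _; case: asboolP => Bx.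
  by rewrite -v_mass; congr integral; apply/seteqP; split.
rewrite -[RHS](integral_set0 L (fun y => (v i y)%:E)); congr integral.
by apply/seteqP; split.
Qed.

Let fstu A : measurable A ->
  gam0 (fst @^-1` A) = (\int[lam]_(y in A `&` (Om : set T)) (u y)%:E)%E.
Proof.
move=> mA; rewrite fst1 -integral_nneseries//; last 2 first.
- by move=> i; exact/measurable_funTS/measurable_EFinP.
- by move=> i y _; rewrite lee_fin.
transitivity (\int[L]_(y in A) (u y)%:E)%E.
  apply: ge0_ae_eq_integral => //.
  - by apply: ge0_emeasurable_sum => [i y _ _|i _];
      [rewrite lee_fin|exact/measurable_funTS/measurable_EFinP].
  - exact/measurable_funTS/measurable_EFinP.
  - by move=> y _; apply: nneseries_ge0 => i _ _; rewrite lee_fin.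
  - by move=> y _; rewrite lee_fin.
  - by apply: filterS uE => y -> _.
rewrite integral_mkcond ge0_integral_mrestr; last 2 first.
- by apply/(measurable_restrictT _ mA); exact/measurable_funTS/measurable_EFinP.
- by move=> y; rewrite patchE; case: ifP => //; rewrite lee_fin.
by rewrite -integral_mkcondr setIC.
Qed.

(** Inequalities are enough for a minimizer: the plan is one competitor for [Tp], [u] is one
    density, and where points [x i] coincide subadditivity of [g] can only lower the cost of
    atoms. *)
Lemma reconstruction : exists mu nu : probability T R,
  [/\ in_P Om mu, in_P Om nu,
      (Tp p mu nu <= \sum_(i <oo) \int[L]_y (cost p y (x i) * v i y)%:E)%E,
      (Ffun Om lam f mu <= \int[L]_y posext f (u y))%E &
      (Gfun g nu <= \sum_(i <oo) g (al i))%E].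
Proof.
have [P PE] := probability_of_measure gam0T.
have mu1 : image_measure gam0 (@measurable_fst _ _ T T) setT = 1%E.
  by rewrite -gam0T.
have nu1 : image_measure gam0 (@measurable_snd _ _ T T) setT = 1%E.
  by rewrite -gam0T.
have [mu muE'] := probability_of_measure mu1.
have [nu nuE'] := probability_of_measure nu1.
have muE A : mu A = gam0 (fst @^-1` A) by exact: muE'.
have nuE A : nu A = gam0 (snd @^-1` A) by exact: nuE'.
have term0 B i : (0 <= if `[< B (x i) >] then (al i)%:E else 0)%E.
  by case: ifP => _ //; rewrite lee_fin.
exists mu, nu; split.
- rewrite /in_P muE fstu; last exact: measurableC.
  by rewrite setICl integral_set0.
- rewrite /in_P nuE snd1; apply: eseries0 => i _ _.
  by case: asboolP => //; case; exact: xOm.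
- apply: (@le_trans _ _ (\int[P]_(z in setT) (cost p z.1 z.2)%:E)%E).
    apply: ereal_inf_lbound; exists P => //; split=> A mA.
      by rewrite PE muE.
    by rewrite PE nuE.
  have mc : measurable_fun setT (fun z : (T * T)%type => (cost p z.1 z.2)%:E).
    by apply/measurable_EFinP; exact: measurable_cost.
  have c0 (z : (T * T)%type) : (0 <= (cost p z.1 z.2)%:E)%E.
    by rewrite lee_fin cost_ge0.
  rewrite (_ : (\int[P]_z _ = \int[gam0]_z (cost p z.1 z.2)%:E)%E); last first.
    by apply: eq_measure_integral => A mA _; exact: PE.
  rewrite ge0_integral_measure_series//.
  rewrite le_eqVlt; apply/orP; left; apply/eqP; apply: eq_eseriesr => i _.
  rewrite ge0_integral_image_measure//.
  have mci : measurable_fun (setT : set T) (fun y : T => (cost p y (x i))%:E).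
    by apply/measurable_EFinP; exact: measurable_costr.
  rewrite (@integral_density _ _ _ L _ (v i) (mv i) (v0 i))//.
- have mpf : measurable_fun setT (posext f).
    by apply: lower_semicontinuous_measurable; exact: posext_lsc.
  rewrite ge0_integral_mrestr; last 2 first.
  + exact: measurableT_comp.
  + by move=> y; exact: posext_ge0.
  apply: ereal_inf_lbound; exists u.
    split => //.
    + exact: measurable_funTS.
    + apply/integrableP; split; first exact/measurable_funTS/measurable_EFinP.
      have := fstu measurableT; rewrite preimage_setT gam0T setTI => e.
      under eq_integral do rewrite /= ger0_norm//.
      by rewrite -e ltry.
    + by move=> A mA; rewrite muE fstu.
  by apply: eq_integral => y _; rewrite posextE.
- have al1 i : 0 <= al i <= 1.
    rewrite al0 /= -lee_fin -al_sum1 (nneseriesD1 (n := i))//; last first.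
      by move=> k _; rewrite lee_fin.
    by rewrite leeDl// nneseries_ge0// => k _ _; rewrite lee_fin.
  have gal0 i : (0 <= g (al i))%E by exact: g_ge0.
  (* A point [x i] that is no atom carries no mass, so [nu] is concentrated on its atoms. *)
  have at_x i : ~ atoms nu (x i) -> al i = 0.
    rewrite /atoms /= nuE snd1 => /negP; rewrite -leNgt => le0.
    apply/eqP; rewrite eq_le al0 andbT -lee_fin; apply: le_trans le0.
    rewrite (@nneseriesD1 _ _ i) //.
    rewrite (asboolT (P := [set x i] (x i)))// -[leLHS]adde0 leeD2l//.
    by apply: nneseries_ge0 => k _ _; exact: term0.
  rewrite /Gfun nuE snd1 eseries0 ?eqxx; last first.
    by move=> i _ _; case: asboolP => // /at_x ->.
  apply: ge_ereal_sup => _ [X [finX XA] <-].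
  (* The mass at [y] collects all [al i] with [x i = y], possibly infinitely many, hence countable
     subadditivity. *)
  have gy y : (g (fine (nu [set y])) <=
      \sum_(i <oo) if x i == y then g (al i) else 0)%E.
    have s1 : fine (nu [set y]) <= 1.
      by rewrite -lee_fin fineK ?fin_num_measure// ?probability_le1//;
        exact: measurable_set1_Rn.
    have E : (\sum_(i <oo) (if x i == y then al i else 0)%:E =
        (fine (nu [set y]))%:E)%E.
      rewrite fineK ?fin_num_measure//; last exact: measurable_set1_Rn.
      rewrite nuE snd1; apply: eq_eseriesr => i _ /=.
      by case: eqP => [->|ne]; [rewrite asboolT|rewrite asboolF].
    have a0 i : 0 <= (if x i == y then al i else 0) by case: ifP.
    apply: le_trans (subadditive_series g_ge0 g_sub g_lsc g0 a0 E s1) _.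
    rewrite le_eqVlt; apply/orP; left; apply/eqP; apply: eq_eseriesr => i _.
    by case: ifP.
  rewrite fsbig_finite//=.
  have := finmap.fset_uniq (fset_set X).
  set s := finmap.enum_fset (fset_set X) => us.
  apply: le_trans (lee_sum _ (fun y _ => gy y)) _.
  rewrite -nneseries_sum//; last first.
    by move=> *; case: ifP => _ //; exact: gal0.
  apply: lee_nneseries => i _.
    by move=> _; apply: sume_ge0 => y _; case: ifP => _ //; exact: gal0.
  (* For fixed [i] at most one [y] equals [x i], so each [g (al i)] is counted at most once. *)
  rewrite -big_mkcond /=; have [xs|xs] := boolP ((x i : T) \in s).
    rewrite (eq_bigl (pred1 (x i : T))); last by move=> y /=; rewrite eq_sym.
    by rewrite -big_filter filter_pred1_uniq// big_seq1.
  rewrite big_seq_cond big1// => y /andP[ys /eqP xy].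
  by rewrite -xy in ys; rewrite ys in xs.
Qed.

End reconstruction.

(** * Uniform mass estimates for configurations *)

Lemma configuration_le1 (R : realType) (n : nat) (Om : set 'rV[R]_n)
    (L : {measure set (Rn R n) -> \bar R}) p f g x w a Tc Fc Gc N :
  configuration Om L p f g x w a Tc Fc Gc -> \sum_(i < N) a i <= 1.
Proof.
move=> cfg; rewrite -lee_fin -(cfg_sum1 cfg) -sumEFin.
rewrite -(big_mkord xpredT (fun i => (a i)%:E)).
by apply: nneseries_lim_ge => i _; rewrite lee_fin (cfg_ge0 cfg).
Qed.

Lemma configuration_mass_le1 (R : realType) (n : nat) (Om : set 'rV[R]_n)
    (L : {measure set (Rn R n) -> \bar R}) p f g x w a Tc Fc Gc i :
  configuration Om L p f g x w a Tc Fc Gc -> a i <= 1.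
Proof.
move=> cfg; apply: le_trans (configuration_le1 i.+1 cfg).
by rewrite big_ord_recr /= lerDr sumr_ge0// => j _; exact: cfg_ge0 cfg _.
Qed.

(* The decay [a i <= 2 / i.+1] puts all late atoms in the region where [g] is
   steep, so their total mass is controlled by the energy alone. *)
Lemma configuration_tail (R : realType) (g : R -> \bar R) (B e : R) :
  (forall t : R, 0 <= t <= 1 -> (0 <= g t)%E) -> g 0 = 0%E ->
  (g t * (t^-1)%:E)%E @[t --> 0^'+] --> +oo%E -> 0 < B -> 0 < e ->
  exists N, forall (n : nat) (Om : set 'rV[R]_n)
    (L : {measure set (Rn R n) -> \bar R}) p f x w a Tc Fc Gc,
    configuration Om L p f g x w a Tc Fc Gc -> Gc <= B ->
    1 - e <= \sum_(i < N) a i.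
Proof.
move=> g_ge0 g0 gs B0 e0.
(* At slope [B / e] a tail of mass more than [e] would cost more than [B]. *)
have M0 : 0 < B / e by rewrite divr_gt0.
have [dl dl0 Hdl] := steep_at0 g0 gs (B / e).
(* From this index on the decay bound [2 / i.+1] is below [dl]; [N] depends on [g], [B] and [e]
   alone. *)
pose N := Num.truncn (2 / dl); exists N => n Om L p f x w a Tc Fc Gc cfg GB.
have a0 := cfg_ge0 cfg.
have a1 i : a i <= 1 by exact: configuration_mass_le1 cfg.
have ga i : (0 <= g (a i))%E by apply: g_ge0; rewrite a0 a1.
have small i : (N <= i)%N -> a i <= dl.
  move=> Ni; have i0 : (0 : R) < i.+1%:R by rewrite ltr0n.
  rewrite -(ler_pM2r i0); apply: le_trans (cfg_decay cfg i) _.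
  rewrite mulrC -ler_pdivrMr//; apply: ltW; apply: lt_le_trans (truncnS_gt _) _.
  by rewrite ler_nat ltnS.
have tail N' : \sum_(N <= i < N') a i <= e.
  rewrite -(ler_pM2l M0) divfK ?gt_eqF// -lee_fin mulr_sumr -sumEFin.
  apply: (@le_trans _ _ (\sum_(N <= i < N') g (a i))%E).
    rewrite big_nat_cond [leRHS]big_nat_cond; apply: lee_sum => i.
    by rewrite andbT => /andP[Ni _]; apply: Hdl => //; exact: small.
  apply: (@le_trans _ _ (\sum_(0 <= i < N') g (a i))%E).
    have [NN|NN] := leqP N N'; last first.
      by rewrite big_geq ?(ltnW NN)// sume_ge0.
    by rewrite [leRHS](big_cat_nat _ NN)//= leeDr// sume_ge0.
  rewrite big_mkord; apply: le_trans (cfg_G cfg N') _.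
  by rewrite lee_fin.
rewrite lerBlDr -lee_fin -(cfg_sum1 cfg); apply: lime_le.
  by apply: is_cvg_nneseries => i _ _; rewrite lee_fin.
apply: nearW => N'; rewrite sumEFin lee_fin.
have [NN|NN] := leqP N N'.
  by rewrite (big_cat_nat _ NN)//= big_mkord lerD2l.
apply: (@le_trans _ _ (\sum_(0 <= i < N) a i)).
  by rewrite [leRHS](big_cat_nat _ (ltnW NN))//= lerDl sumr_ge0.
by rewrite big_mkord lerDl ltW.
Qed.

Lemma cvg_row (R : realType) (n : nat) (x : nat -> 'rV[R]_n) (l : 'rV[R]_n) :
  (forall j, x k ord0 j @[k --> \oo] --> l ord0 j) -> x k @[k --> \oo] --> l.
Proof.
move=> xl; apply/cvg_ballP => e e0.
have H : \forall k \near \oo, forall j, ball (l ord0 j) e (x k ord0 j).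
  apply: filter_forall => j; have /cvg_ballP := xl j; exact.
by apply: filterS H => k Hk; split=> // i j; rewrite ord1; exact: Hk.
Qed.

(** * Passing to the limit along a minimizing sequence *)

Section existence.
Context (R : realType) (n : nat).
Local Notation T := (Rn R n).
Variables (Om : set 'rV[R]_n) (p : R) (lam : {measure set T -> \bar R}).
Variables (f : \bar R -> \bar R) (g : R -> \bar R).
Hypothesis Hlam : is_lebesgue lam.
Hypothesis cOm : compact Om.
Hypothesis p1 : 1 <= p.
Hypothesis f0 : forall x : \bar R, (0 <= x)%E -> (0 <= f x)%E.
Hypothesis f_lsc : lsc_on [set x : \bar R | (0 <= x)%E] f.
Hypothesis f_convex : forall (x y : \bar R) (t : R), (0 <= x)%E -> (0 <= y)%E ->
  0 <= t <= 1 -> (f (t%:E * x + (1 - t)%:E * y) <= t%:E * f x + (1 - t)%:E * f y)%E.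
Hypothesis f00 : f 0%E = 0%E.
Hypothesis f_superlinear : (f t%:E * (t^-1)%:E)%E @[t --> +oo] --> +oo%E.
Hypothesis g_ge0 : forall t : R, 0 <= t <= 1 -> (0 <= g t)%E.
Hypothesis g_sub : forall x y : R, 0 <= x -> 0 <= y -> x + y <= 1 ->
  (g (x + y)%R <= g x + g y)%E.
Hypothesis g_lsc : lsc_on [set t : R | 0 <= t <= 1] g.
Hypothesis g0 : g 0 = 0%E.
Hypothesis g_steep : (g t * (t^-1)%:E)%E @[t --> 0^'+] --> +oo%E.

Let mOm : measurable (Om : set T) := compact_measurable_Rn cOm.
Let lamOm : (lam Om < +oo)%E := compact_lebesgue_lty Hlam cOm.
Let L : {measure set T -> \bar R} := mrestr lam mOm.

Let Tp_ge0 (mu nu : probability T R) : (0 <= Tp p mu nu)%E.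
Proof.
apply: le_ereal_inf_tmp => _ [gam _ <-]; apply: integral_ge0 => z _.
by rewrite lee_fin powR_ge0.
Qed.

Let Ffun_ge0 (mu : probability T R) : (0 <= Ffun Om lam f mu)%E.
Proof.
apply: le_ereal_inf_tmp => _ [u [_ u0 _ _] <-]; apply: integral_ge0 => y Oy.
by apply: f0; rewrite lee_fin u0.
Qed.

Let Gfun_ge0 (nu : probability T R) : (0 <= Gfun g nu)%E.
Proof.
rewrite /Gfun; case: ifP => // _; apply: esum_ge0 => y _; apply: g_ge0.
have my : measurable ([set y] : set T) by exact: measurable_set1_Rn.
by rewrite fine_ge0//= -lee_fin fineK ?fin_num_measure// probability_le1.
Qed.

Lemma Fp_ge0 (mu nu : probability T R) : (0 <= Fp Om p lam f g mu nu)%E.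
Proof. by rewrite /Fp !adde_ge0. Qed.

Lemma near_configuration (mu nu : probability T R) (c : R) :
  Om !=set0 -> in_P Om mu -> in_P Om nu -> (Fp Om p lam f g mu nu < c%:E)%E ->
  exists x w a Tc Fc Gc, [/\ configuration Om L p f g x w a Tc Fc Gc,
    0 <= Tc, 0 <= Fc, 0 <= Gc & Tc + Fc + Gc <= c].
Proof.
move=> [x0 Ox0] muO nuO; rewrite /Fp => lt_c.
have T0 := Tp_ge0 mu nu; have F0 := Ffun_ge0 mu; have G0 := Gfun_ge0 nu.
have ltoo := lt_trans lt_c (ltry c).
have Tfin : Tp p mu nu \is a fin_num.
  by rewrite ge0_fin_numE//; apply: le_lt_trans ltoo; rewrite -addeA leeDl// adde_ge0.
have Ffin : Ffun Om lam f mu \is a fin_num.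
  rewrite ge0_fin_numE//; apply: le_lt_trans ltoo.
  by rewrite (addeC (Tp _ _ _)) -addeA leeDl// adde_ge0.
have Gfin : Gfun g nu \is a fin_num.
  by rewrite ge0_fin_numE//; apply: le_lt_trans ltoo; rewrite leeDr// adde_ge0.
pose t := fine (Tp p mu nu); pose F := fine (Ffun Om lam f mu).
pose G := fine (Gfun g nu).
have ET : Tp p mu nu = t%:E by rewrite fineK.
have EF : Ffun Om lam f mu = F%:E by rewrite fineK.
have EG : Gfun g nu = G%:E by rewrite fineK.
move: lt_c T0 F0 G0; rewrite ET EF EG -!EFinD lte_fin !lee_fin => tc t0 F0 G0.
(* [Tp] and [Ffun] are infima and each receives half of the gap; [Gfun] is a sum and is taken
   exactly. *)
pose e := (c - (t + F + G)) / 2.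
have e0 : 0 < e by rewrite divr_gt0// subr_gt0.
have [_ [gam cpl <-] Hgam] := lb_ereal_inf_adherent e0 Tfin.
have [_ [u du <-] Hu] := lb_ereal_inf_adherent e0 Ffin.
rewrite -/(Tp p mu nu) ET -EFinD in Hgam.
rewrite -/(Ffun Om lam f mu) EF -EFinD in Hu.
move: EG; rewrite /Gfun; case: eqP => // nuat EG.
have HG : (\esum_(y in atoms nu) g (fine (nu [set y])) <= G%:E)%E by rewrite EG.
have [x [w [a cfg]]] := disintegration mOm lamOm f0 f_lsc
  (posext_nondecreasing f0 f_convex f00) g0 nuO nuat cpl du Ox0
  (ltW Hgam) (ltW Hu) HG.
exists x, w, a, (t + e), (F + e), G; split => //; try exact: addr_ge0 (ltW e0).
by rewrite /e; lra.
Qed.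

Lemma configuration_limit (J : R) (x : nat -> nat -> 'rV[R]_n)
    (w : nat -> nat -> T -> R) (a : nat -> nat -> R) (Tc Fc Gc : nat -> R) :
  (forall k, configuration Om L p f g (x k) (w k) (a k) (Tc k) (Fc k) (Gc k)) ->
  (forall k, [/\ 0 <= Tc k, 0 <= Fc k, 0 <= Gc k &
    Tc k + Fc k + Gc k <= J + k.+1%:R^-1]) ->
  exists mu nu : probability T R,
    [/\ in_P Om mu, in_P Om nu & (Fp Om p lam f g mu nu <= J%:E)%E].
Proof.
move=> cfg en.
have a0 k i : 0 <= a k i by exact: cfg_ge0 (cfg k) i.
have a1 k i : a k i <= 1 by exact: configuration_mass_le1 (cfg k).
have ga0 k i : (0 <= g (a k i))%E by apply: g_ge0; rewrite a0 a1.
have [M HM] := compact_bounded_Rn cOm.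
pose B := J + 1.
have kB k : k.+1%:R^-1 <= 1 :> R by rewrite invf_le1 ?ler1n// ltr0n.
have enB k : Tc k + Fc k + Gc k <= B.
  by have [_ _ _ H] := en k; apply: le_trans H _; rewrite lerD2l.
have TB k : Tc k <= B by have [t0 t1 t2 _] := en k; have t4 := enB k; lra.
have FB k : Fc k <= B by have [t0 t1 t2 _] := en k; have t4 := enB k; lra.
have GB k : Gc k <= B by have [t0 t1 t2 _] := en k; have t4 := enB k; lra.
have B0 : 0 <= B by have [t0 _ _ _] := en 0%N; have t1 := TB 0%N; lra.
have gaB k i : (g (a k i) <= (Gc k)%:E)%E.
  apply: le_trans (cfg_G (cfg k) i.+1); rewrite big_ord_recr /= leeDr//.
  by apply: sume_ge0.
have gafin k i : g (a k i) \is a fin_num.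
  by rewrite ge0_fin_numE// (le_lt_trans (gaB k i)) ?ltry.
pose gr k i := fine (g (a k i)).
have grE k i : g (a k i) = (gr k i)%:E by rewrite /gr fineK.
(* One countable index for coordinates, masses, values of [g] and energies, so that a single
   subsequence serves them all. *)
pose Idx : countType := (nat * 'I_n + (nat + (nat + (bool + unit))))%type.
pose q (k : nat) (j : Idx) : R := match j with
  | inl ij => x k ij.1 ord0 ij.2
  | inr (inl i) => a k i
  | inr (inr (inl i)) => gr k i
  | inr (inr (inr (inl true))) => Tc k
  | inr (inr (inr (inl false))) => Fc k
  | inr (inr (inr (inr _))) => Gc k end.
have qB k j : `|q k j| <= (match j with inl _ => M | inr (inl _) => 1 | _ => B end).
  case: j => [[i j]|[i|[i|[[|]|[]]]]] /=.
  - exact: HM (cfg_Om (cfg k) i) j.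
  - by rewrite ger0_norm.
  - rewrite ger0_norm ?fine_ge0// -lee_fin -grE.
    by apply: le_trans (gaB k i) _; rewrite lee_fin.
  - by rewrite ger0_norm//; have [] := en k.
  - by rewrite ger0_norm//; have [] := en k.
  - by rewrite ger0_norm//; have [] := en k.
have [ph [l [phk ql]]] := cvg_subseq_family qB.
pose xl i : 'rV[R]_n := \row_j l (inl (i, j)).
pose al i := l (inr (inl i)).
pose gl i := l (inr (inr (inl i))).
pose Tl := l (inr (inr (inr (inl true)))).
pose Fl := l (inr (inr (inr (inl false)))).
pose Gl := l (inr (inr (inr (inr tt)))).
have cx i : x (ph k) i @[k --> \oo] --> xl i.
  by apply: cvg_row => j; rewrite mxE; exact: (ql (inl (i, j))).
have ca i : a (ph k) i @[k --> \oo] --> al i by exact: (ql (inr (inl i))).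
have cg i : gr (ph k) i @[k --> \oo] --> gl i by exact: (ql (inr (inr (inl i)))).
have cT : Tc (ph k) @[k --> \oo] --> Tl by exact: (ql (inr (inr (inr (inl true))))).
have cF : Fc (ph k) @[k --> \oo] --> Fl by exact: (ql (inr (inr (inr (inl false))))).
have cG : Gc (ph k) @[k --> \oo] --> Gl by exact: (ql (inr (inr (inr (inr tt))))).
have cvg_le (y z : nat -> R) (ly lz : R) : y k @[k --> \oo] --> ly ->
    z k @[k --> \oo] --> lz -> (forall k, y k <= z k) -> ly <= lz.
  move=> yl zl yz; rewrite -(cvg_lim (@Rhausdorff R) yl) -(cvg_lim (@Rhausdorff R) zl).
  by apply: ler_lim; [apply/cvg_ex; exists ly|apply/cvg_ex; exists lz|exact: nearW].
have cvgS (y : nat -> nat -> R) (ly : nat -> R) N :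
    (forall i, y k i @[k --> \oo] --> ly i) ->
    \sum_(i < N) y k i @[k --> \oo] --> \sum_(i < N) ly i.
  by move=> yl; apply: cvg_big => [|i _]; [exact: add_continuous|exact: yl].
have xlOm i : Om (xl i).
  have hrV : hausdorff_space 'rV[R]_n by exact: norm_hausdorff.
  have clO := compact_closed hrV cOm.
  apply: (closed_cvg Om clO _ (xl i) (cx i)).
  by apply: nearW => k; exact: cfg_Om (cfg _) i.
have al0 i : 0 <= al i by apply: (cvg_le _ _ _ _ (cvg_cst 0) (ca i)).
have alS1 N : \sum_(i < N) al i <= 1.
  apply: (cvg_le _ _ _ _ (cvgS (fun k => a (ph k)) al N ca) (cvg_cst (1 : R))) => k.
  exact: configuration_le1 (cfg _).
have al_sum1 : (\sum_(i <oo) (al i)%:E = 1)%E.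
  apply/eqP; rewrite eq_le; apply/andP; split.
    apply: lime_le; first by apply: is_cvg_nneseries => i _ _; rewrite lee_fin.
    by apply: nearW => N; rewrite sumEFin big_mkord lee_fin.
  (* The first [N] atoms keep mass [1 - e] uniformly along the sequence, and a finite sum passes to
     the limit. [B + 1] is used because the tail estimate asks for a positive bound. *)
  apply/lee_addgt0Pr => e e0.
  have B1 : 0 < B + 1 by rewrite ltr_pwDr.
  have [N HN] := configuration_tail g_ge0 g0 g_steep B1 e0.
  have SN : 1 - e <= \sum_(i < N) al i.
    apply: (cvg_le _ _ _ _ (cvg_cst (1 - e : R)) (cvgS (fun k => a (ph k)) al N ca)) => k.
    by apply: HN (cfg _) _; apply: le_trans (GB _) _; rewrite lerDl.
  rewrite -leeBlDr// -EFinB; apply: (@le_trans _ _ (\sum_(i < N) al i)%:E).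
    by rewrite lee_fin.
  rewrite -sumEFin -(big_mkord xpredT (fun i => (al i)%:E)).
  by apply: nneseries_lim_ge => i _; rewrite lee_fin.
have Loo : (L setT < +oo)%E by rewrite /L /= /mrestr setTI.
have nnw k : nnfam (w (ph k)) by exact: cfg_nn (cfg _).
have w0 k i y : 0 <= w (ph k) i y by have [_] := nnw k i.
have mw k i : measurable_fun setT (w (ph k) i) by have [] := nnw k i.
have mc i : measurable_fun (setT : set T) (fun y : T => cost p y (xl i)).
  exact: measurable_costr.
have mcx k i : measurable_fun (setT : set T) (fun y : T => cost p y (x k i)).
  exact: measurable_costr.
(* The costs at moving and limit points are compared only for [y] in [Om], where [L] is
   concentrated. *)
have aeOm : {ae L, forall y : T, (Om : set T) y}.
  exists (~` (Om : set T)); split; first exact: measurableC.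
    by rewrite /L /= /mrestr setICl measure0.
  by move=> y.
(* Moving the points to their limits changes the cost by at most [e / 2] times a total mass of at
   most 1; the other [e / 2] covers the convergence of [Tc]. The weights are then independent of
   [k]. *)
have w_C N (e : R) : 0 < e -> \forall k \near \oo,
    (\int[L]_y (\sum_(i < N) cost p y (xl i) * w (ph k) i y)%:E <= (Tl + e)%:E)%E.
  move=> e0; have e2 : 0 < e / 2 by rewrite divr_gt0.
  have H1 : \forall k \near \oo, forall i : 'I_N, forall y, Om y ->
      `|cost p y (x (ph k) i) - cost p y (xl i)| <= e / 2.
    apply: filter_forall => i.
    exact: (cx i) (cost_near_uniform (xl i) p1 cOm e2).
  have H2 : \forall k \near \oo, Tc (ph k) < Tl + e / 2.
    by apply: (cvgr_lt Tl cT); rewrite ltrDl.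
  apply: filterS2 H1 H2 => k H1 H2.
  have mS : measurable_fun setT (fun y : T =>
      (\sum_(i < N) cost p y (x (ph k) i) * w (ph k) i y)%:E).
    by apply/measurable_EFinP/measurable_sum => i; exact: measurable_funM.
  have mS' : measurable_fun setT (fun y : T => (e / 2 * \sum_(i < N) w (ph k) i y)%:E).
    by apply/measurable_EFinP/measurable_funM => //; exact: measurable_sum.
  have S0 y : 0 <= \sum_(i < N) cost p y (x (ph k) i) * w (ph k) i y.
    by apply: sumr_ge0 => i _; rewrite mulr_ge0// cost_ge0.
  have S0' y : 0 <= e / 2 * \sum_(i < N) w (ph k) i y.
    by apply: mulr_ge0; [exact: ltW|exact: sumr_ge0].
  apply: (@le_trans _ _ (\int[L]_y ((\sum_(i < N) cost p y (x (ph k) i) *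
      w (ph k) i y)%:E + (e / 2 * \sum_(i < N) w (ph k) i y)%:E))%E).
    apply: ae_ge0_le_integral.
    - exact: measurableT.
    - by move=> y _; rewrite lee_fin sumr_ge0// => i _; rewrite mulr_ge0// cost_ge0.
    - by apply/measurable_EFinP/measurable_sum => i; exact: measurable_funM.
    - by move=> y _; rewrite -EFinD lee_fin addr_ge0.
    - exact: emeasurable_funD.
    - move: aeOm; apply: (@filterS _ _ (ae_filter_ringOfSetsType L)) => y Oy _.
      rewrite -EFinD lee_fin mulr_sumr -big_split /=.
      apply: ler_sum => i _; rewrite -mulrDl ler_wpM2r//.
      by rewrite addrC -lerBlDr; have := H1 i y Oy; rewrite distrC; exact/le_trans/ler_norm.
  rewrite ge0_integralD//; last 2 first.
  - by move=> y _; rewrite lee_fin.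
  - by move=> y _; rewrite lee_fin.
  rewrite (_ : Tl + e = (Tl + e / 2) + e / 2); last by field.
  rewrite EFinD; apply: leeD.
    by apply: le_trans (cfg_T (cfg (ph k)) N) _; rewrite lee_fin ltW.
  under eq_integral do rewrite EFinM -sumEFin.
  have mW : measurable_fun setT (fun y : T => \sum_(i < N) (w (ph k) i y)%:E)%E.
    under eq_fun do rewrite sumEFin.
    by apply/measurable_EFinP; exact: measurable_sum.
  rewrite (ge0_integralZl L measurableT mW)//; last 2 first.
  - by move=> y _; apply: sume_ge0 => i _; rewrite lee_fin.
  - by rewrite lee_fin ltW.
  rewrite ge0_integral_sum//; last 2 first.
  - by move=> i; exact/measurable_EFinP.
  - by move=> i y _; rewrite lee_fin.
  under eq_bigr do rewrite (cfg_mass (cfg (ph k))).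
  rewrite sumEFin -EFinM lee_fin ger_pMr//.
  exact: configuration_le1 (cfg _).
have w_F N (e : R) : 0 < e -> \forall k \near \oo,
    (\int[L]_y posext f (\sum_(i < N) w (ph k) i y) <= (Fl + e)%:E)%E.
  move=> e0; have H : \forall k \near \oo, Fc (ph k) < Fl + e.
    by apply: (cvgr_lt Fl cF); rewrite ltrDl.
  apply: filterS H => k Fk; apply: le_trans (cfg_F (cfg (ph k)) N) _.
  by rewrite lee_fin ltW.
have w_mass i (e : R) : 0 < e -> \forall k \near \oo,
    ((al i - e)%:E <= \int[L]_y (w (ph k) i y)%:E <= (al i + e)%:E)%E.
  move=> e0.
  have H1 : \forall k \near \oo, a (ph k) i < al i + e.
    by apply: (cvgr_lt _ (ca i)); rewrite ltrDl.
  have H2 : \forall k \near \oo, al i - e < a (ph k) i.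
    by apply: (cvgr_gt _ (ca i)); rewrite ltrBlDr ltrDl.
  apply: filterS2 H1 H2 => k H1 H2; rewrite (cfg_mass (cfg (ph k))) !lee_fin.
  by rewrite !ltW.
have al_lty : (\sum_(i <oo) (al i)%:E < +oo)%E by rewrite al_sum1 ltry.
have w_le1 k i : (\int[L]_y (w (ph k) i y)%:E <= 1)%E.
  by rewrite (cfg_mass (cfg (ph k))) lee_fin.
have c0 i : measurable_fun (setT : set T) (fun y : T => cost p y (xl i)) /\
    forall y : T, 0 <= cost p y (xl i).
  by split=> // y; exact: cost_ge0.
have [v [u [nv vm [mu_ u0 uE] HF HC]]] := convex_limit Loo nnw (posext_ge0 f0)
  (posext_nondecreasing f0 f_convex f00) (posext_lsc f_lsc)
  (posext_mid f0 f_convex) (posext_superlinear f_superlinear)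
  c0 w_le1 w_mass al_lty w_F w_C.
have [mu [nu [muO nuO HT HF' HG]]] := reconstruction p f0 f_lsc
  g_ge0 g_sub g_lsc g0 xlOm nv vm al0 al_sum1 mu_ u0 uE.
exists mu, nu; split => //.
(* No averaging here: lower semicontinuity bounds each [g (al i)] by the limit [gl i], and finite
   sums of the [gl i] stay below [Gl]. *)
have HGl : (Gfun g nu <= Gl%:E)%E.
  apply: le_trans HG _; apply: lime_le.
    apply: is_cvg_nneseries => i _ _; apply: g_ge0; rewrite al0 /=.
    by apply: (cvg_le _ _ _ _ (ca i) (cvg_cst (1 : R))).
  apply: nearW => N; rewrite big_mkord.
  apply: (@le_trans _ _ (\sum_(i < N) gl i)%:E).
    rewrite -sumEFin; apply: lee_sum => i _.
    apply: (lsc_cvg g_lsc _ _ (ca i) (cg i)) => k; first by rewrite a0 a1.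
    by rewrite grE.
  rewrite lee_fin; apply: (cvg_le _ _ _ _ (cvgS (fun k => gr (ph k)) gl N cg) cG) => k.
  rewrite -lee_fin -sumEFin; apply: le_trans (cfg_G (cfg (ph k)) N).
  by apply: lee_sum => i _; rewrite grE.
have TFG : Tl + Fl + Gl <= J.
  apply/ler_addgt0Pr => e e0.
  have c1 : Tc (ph k) + Fc (ph k) + Gc (ph k) @[k --> \oo] --> Tl + Fl + Gl.
    by apply: cvgD => //; exact: cvgD.
  rewrite -(cvg_lim (@Rhausdorff R) c1); apply: limr_le.
    by apply/cvg_ex; exists (Tl + Fl + Gl).
  near=> k; have [_ _ _ H] := en (ph k); apply: le_trans H _; rewrite lerD2l.
  apply: (@le_trans _ _ k.+1%:R^-1).
    by rewrite lef_pV2 ?posrE ?ltr0n// ler_nat ltnS.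
  by apply: ltW; near: k; exact: near_infty_natSinv_lt (PosNum e0).
rewrite /Fp; apply: (@le_trans _ _ (Tl + Fl + Gl)%:E); last by rewrite lee_fin.
rewrite !EFinD; apply: leeD => //; apply: leeD.
  exact: le_trans HT HC.
exact: le_trans HF' HF.
Unshelve. all: by end_near. Qed.

End existence.

Theorem theorem2p1 (R : realType) (n : nat) (Om : set 'rV[R]_n) (p : R)
    (lam : {measure set (Rn R n) -> \bar R})
    (f : \bar R -> \bar R) (g : R -> \bar R) :
  is_lebesgue lam ->
  compact Om -> Om !=set0 ->
  1 <= p ->
  (* f : [0,+oo] -> [0,+oo], lsc, convex, f(0) = 0, superlinear *)
  (forall x : \bar R, (0 <= x)%E -> (0 <= f x)%E) ->
  lsc_on [set x : \bar R | (0 <= x)%E] f ->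
  (forall (x y : \bar R) (t : R), (0 <= x)%E -> (0 <= y)%E -> 0 <= t <= 1 ->
     (f (t%:E * x + (1 - t)%:E * y) <= t%:E * f x + (1 - t)%:E * f y)%E) ->
  f 0%E = 0%E ->
  (f t%:E * (t^-1)%:E)%E @[t --> +oo] --> +oo%E ->
  (* g : [0,1] -> [0,+oo], subadditive, lsc, g(0) = 0, g(t)/t -> +oo at 0+ *)
  (forall t : R, 0 <= t <= 1 -> (0 <= g t)%E) ->
  (forall x y : R, 0 <= x -> 0 <= y -> x + y <= 1 -> (g (x + y)%R <= g x + g y)%E) ->
  lsc_on [set t : R | 0 <= t <= 1] g ->
  g 0 = 0%E ->
  (g t * (t^-1)%:E)%E @[t --> 0^'+] --> +oo%E ->
  exists mu nu : probability (Rn R n) R,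
    [/\ in_P Om mu, in_P Om nu &
        forall mu' nu' : probability (Rn R n) R, in_P Om mu' -> in_P Om nu' ->
          (Fp Om p lam f g mu nu <= Fp Om p lam f g mu' nu')%E].
Proof.
move=> Hlam cOm Om0 p1 f0 f_lsc f_convex f00 f_sl g_ge0 g_sub g_lsc g0 g_steep.
pose S := [set Fp Om p lam f g m.1 m.2 | m in
  [set m : probability (Rn R n) R * probability (Rn R n) R |
    in_P Om m.1 /\ in_P Om m.2]].
have S_le mu' nu' : in_P Om mu' -> in_P Om nu' ->
    (ereal_inf S <= Fp Om p lam f g mu' nu')%E.
  by move=> muO nuO; apply: ereal_inf_lbound; exists (mu', nu').
have inf0 : (0 <= ereal_inf S)%E.
  by apply: le_ereal_inf_tmp => _ [m _ <-]; exact: Fp_ge0.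
(* If the infimum is [+oo], every admissible pair is a minimizer, for instance two equal Dirac
   masses in [Om]. *)
case EJ : (ereal_inf S) inf0 => [J| |]// _; last first.
  have [x0 Ox0] := Om0.
  have PO : in_P Om (@dirac _ (Rn R n) x0 R).
    by rewrite /in_P /= diracE memNset// => /(_ Ox0).
  exists (@dirac _ (Rn R n) x0 R), (@dirac _ (Rn R n) x0 R); split => // mu' nu' mO nO.
  by have := S_le _ _ mO nO; rewrite EJ leye_eq => /eqP ->; exact: leey.
have near_min k : exists c : (nat -> 'rV[R]_n) * (nat -> Rn R n -> R) * (nat -> R) *
    (R * R * R),
    configuration Om (mrestr lam (compact_measurable_Rn cOm)) p f g
      c.1.1.1 c.1.1.2 c.1.2 c.2.1.1 c.2.1.2 c.2.2 /\
    [/\ 0 <= c.2.1.1, 0 <= c.2.1.2, 0 <= c.2.2 &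
      c.2.1.1 + c.2.1.2 + c.2.2 <= J + k.+1%:R^-1].
  have k0 : 0 < k.+1%:R^-1 :> R by rewrite invr_gt0 ltr0n.
  have Jfin : ereal_inf S \is a fin_num by rewrite EJ.
  have [_ [[mu nu] [/= muO nuO] <-]] := lb_ereal_inf_adherent k0 Jfin.
  rewrite EJ -EFinD => /(near_configuration Hlam cOm f0 f_lsc f_convex f00 g_ge0 g0
    Om0 muO nuO)[x [w [a [Tc [Fc [Gc [cfg T0 F0 G0 TFG]]]]]]].
  by exists (x, w, a, (Tc, Fc, Gc)).
have [c Hc] := choice near_min.
have [mu [nu [muO nuO FpJ]]] := configuration_limit Hlam p1 f0 f_lsc
  f_convex f00 f_sl g_ge0 g_sub g_lsc g0 g_steep
  (fun k => (Hc k).1) (fun k => (Hc k).2).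
exists mu, nu; split => // mu' nu' muO' nuO'.
by apply: le_trans FpJ _; rewrite -EJ; exact: S_le.
Qed.
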